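(* Let $v\in V(0)$. Then $T_\chi(v)=\sum_{k=1}^{14}T^k_\chi(v)$, where (with $\eta,\tau$ standing for $\pi(\eta),\pi(\tau)$) \begin{align*} T^1_\chi(v)&=q^2\!\!\int\limits_{z\in{\mathfrak o}}\int\limits_{x\in{\mathfrak o}^\times}\int\limits_{b\in{\mathfrak o}^\times}\int\limits_{a\in{\mathfrak o}^\times}\!\!\chi(ab)\,\pi\big(X(-(a+xb)\varpi^{-1})\,Y(b\varpi^{-2},z\varpi^{-4},x^{-1}\varpi^{-1})\big)v,\\ T^2_\chi(v)&=q\,\eta\!\!\int\limits_{y\in{\mathfrak o}^\times\setminus(1+\mathfrak p)}\int\limits_{b\in{\mathfrak o}^\times}\int\limits_{a\in{\mathfrak o}^\times}\int\limits_{x\in{\mathfrak o}^\times\setminus(1+\mathfrak p)}\!\!\chi(abxy)\,\pi\big(X(b\varpi^{-1})\,Y(-a\varpi^{-2},\,ab(1-(1-y)^{-1}x)\varpi^{-3},\,ab^{-1}(1-x)^{-1}\varpi^{-1})\big)v,\\ T^3_\chi(v)&=\eta\!\!\int\limits_{z\in{\mathfrak o}^\times\setminus(1+\mathfrak p)}\int\limits_{b\in{\mathfrak o}^\times}\int\limits_{a\in{\mathfrak o}^\times}\!\!\chi(b(1-z))\,\pi\big(Y(a\varpi^{-2},b\varpi^{-3},a^2b^{-1}z\varpi^{-1})\big)v,\\ T^4_\chi(v)&=q\,\eta\!\!\int\limits_{x\in{\mathfrak o}^\times}\int\limits_{b\in{\mathfrak o}^\times}\int\limits_{a\in{\mathfrak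 o}}\!\!\chi(b)\,\pi\big(X(x\varpi^{-2})\,Y(a\varpi^{-2},(b\varpi-ax)\varpi^{-4},0)\big)v,\\ T^5_\chi(v)&=\eta\!\!\int\limits_{x\in{\mathfrak o}}\int\limits_{b\in{\mathfrak o}^\times}\int\limits_{a\in{\mathfrak o}^\times}\!\!\chi(b)\,\pi\big(X(x\varpi^{-1})\,Y(a\varpi^{-2},(b-ax)\varpi^{-3},0)\big)v,\\ T^6_\chi(v)&=q^{-1}\eta^2\!\!\int\limits_{x,b,a\in{\mathfrak o}^\times}\!\!\chi(bx)\,\pi\big(Y(a\varpi^{-2},b(1-x\varpi)\varpi^{-2},a^2b^{-1}\varpi^{-2})\big)v,\\ T^7_\chi(v)&=q\,\tau\!\!\int\limits_{z\in{\mathfrak o}}\int\limits_{b\in{\mathfrak o}^\times}\int\limits_{a\in{\mathfrak o}^\times}\!\!\chi(ab)\,\pi\big(X(-a\varpi^{-2})\,Y(b\varpi^{-1},z\varpi^{-4},0)\big)v,\\ T^8_\chi(v)&=\eta\tau\!\!\int\limits_{z\in{\mathfrak o}^\times\setminus(1+\mathfrak p)}\int\limits_{b\in{\mathfrak o}^\times}\int\limits_{a\in{\mathfrak o}^\times}\!\!\chi(abz(1-z))\,\pi\big(X(b\varpi^{-2})\,Y(a\varpi^{-1},-ab(1-z)\varpi^{-3},0)\big)v,\\ T^9_\chi(v)&=q^{-2}\eta^2\tau\!\!\int\limits_{x,b,a\in{\mathfrak o}^\times}\!\!\chi(b)\,\pi\big(X(a\varpi^{-1})\,Y(0,-b\varpi^{-1},x\varpi^{-1})\big)v,\\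 T^{10}_\chi(v)&=q^{-3}\eta^2\tau^2\!\!\int\limits_{b,a\in{\mathfrak o}^\times}\!\!\chi(b)\,\pi\big(X(a\varpi^{-2})\,Y(0,-b\varpi^{-1},0)\big)v,\\ T^{11}_\chi(v)&=q^3\tau^{-1}\!\!\int\limits_{z\in{\mathfrak o}}\int\limits_{x\in{\mathfrak o}}\int\limits_{b\in{\mathfrak o}^\times}\int\limits_{a\in{\mathfrak o}^\times}\!\!\chi(ab)\,\pi\big(X(b\varpi^{-1})\,Y((xb+a\varpi)\varpi^{-3},z\varpi^{-4},-x\varpi^{-2})\big)v,\\ T^{12}_\chi(v)&=q^2\eta\tau^{-1}\!\!\int\limits_{z\in{\mathfrak o}^\times\setminus(1+\mathfrak p)}\int\limits_{y\in{\mathfrak o}}\int\limits_{b\in{\mathfrak o}^\times}\int\limits_{a\in{\mathfrak o}^\times}\!\!\chi(abz(1-z))\,\pi\big(X(a\varpi^{-1})\,Y(y\varpi^{-3},\,a(b(1-z)\varpi-y)\varpi^{-4},\,-a^{-1}(y+b\varpi)\varpi^{-2})\big)v,\\ T^{13}_\chi(v)&=\eta^2\tau^{-1}\!\!\int\limits_{x,b,a\in{\mathfrak o}^\times}\!\!\chi(bx)\,\pi\big(Y(a\varpi^{-2},b(1-x)\varpi^{-1},a^2b^{-1}\varpi^{-3})\big)v,\\ T^{14}_\chi(v)&=q\,\eta^2\tau^{-2}\!\!\int\limits_{x\in{\mathfrak o}}\int\limits_{b\in{\mathfrak o}^\times}\int\limits_{a\in{\mathfrak o}^\times}\!\!\chi(b)\,\pi\big(Y(a\varpi^{-2},-b\varpi^{-1},x\varpi^{-4})\big)v.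 \end{align*}
   Context: $F$ is a nonarchimedean local field of characteristic zero with ring of integers ${\mathfrak o}$, uniformizer $\varpi$, maximal ideal $\mathfrak p$, residue field of order $q$. Integrals use the additive Haar measure on $F$ with ${\rm vol}({\mathfrak o})=1$ (restricted to subsets such as ${\mathfrak o}^\times$); integrands are locally constant with compact support, so integrals are finite sums. $\chi$ is a quadratic character of $F^\times$ of conductor $\mathfrak p$ (so $\chi\ne1$, $\chi^2=1$, $\chi(1+\mathfrak p)=1$). Here ${\rm GSp}(4,F)$ is the group of $g\in{\rm GL}(4,F)$ with ${}^tgJ'g=\lambda(g)J'$, $J'=\begin{bmatrix}&&&1\\&&1&\\&-1&&\\-1&&&\end{bmatrix}$. $\mathrm K(\mathfrak p^n)$ is the set of $k\in{\rm GSp}(4,F)$ with $\lambda(k)\in{\mathfrak o}^\times$ and $k\in\begin{bmatrix}{\mathfrak o}&{\mathfrak o}&{\mathfrak o}&\mathfrak p^{-n}\\\mathfrak p^n&{\mathfrak o}&{\mathfrak o}&{\mathfrak o}\\\mathfrak p^n&{\mathfrak o}&{\mathfrak o}&{\mathfrak o}\\\mathfrak p^n&\mathfrak p^n&\mathfrak p^n&{\mathfrak o}\end{bmatrix}$. $(\pi,V)$ is a smooth representation of ${\rm GSp}(4,F)$ with trivial central action; $V(n)$ is the space of $\mathrm K(\mathfrak p^n)$-fixed vectors and $V(n,\chi)$ the space of $v$ with $\pi(k)v=\chi(\lambda(k))v$ for $k\in\mathrm K(\mathfrak p^n)$. Put $\eta={\rm diag}(\varpi^{-1},1,1,\varpi)$,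 $\tau={\rm diag}(1,\varpi^{-1},\varpi,1)$, $t_4=\begin{bmatrix}&&&-\varpi^{-4}\\&1&&\\&&1&\\\varpi^4&&&\end{bmatrix}$, $s_1=\begin{bmatrix}1&&&\\&&1&\\&-1&&\\&&&1\end{bmatrix}$, $L(x)=\begin{bmatrix}1&&&\\&1&&\\&x&1&\\&&&1\end{bmatrix}$, $n(a,b,c)=\begin{bmatrix}1&-a\varpi^{-1}&b\varpi^{-2}&c\\&1&&b\varpi^{-2}\\&&1&a\varpi^{-1}\\&&&1\end{bmatrix}$, $X(s)=\begin{bmatrix}1&s&&\\&1&&\\&&1&-s\\&&&1\end{bmatrix}$, $Y(r,s,t)=\begin{bmatrix}1&&r&s\\&1&t&r\\&&1&\\&&&1\end{bmatrix}$. The twisting operator $T_\chi:V(0)\to V(4,\chi)$ is $T_\chi(v)=q^3\int_{z\in{\mathfrak o}}\int_{x\in{\mathfrak o}}\int_{b\in{\mathfrak o}^\times}\int_{a\in{\mathfrak o}^\times}\chi(ab)\pi(L(x)n(a,b,z\varpi^{-4}))\pi(\tau)v\,+\,q^3\int_{z\in{\mathfrak o}}\int_{y\in\mathfrak p}\int_{b\in{\mathfrak o}^\times}\int_{a\in{\mathfrak o}^\times}\chi(ab)\pi(s_1L(y)n(a,b,z\varpi^{-4}))\pi(\tau)v\,+\,q^2\int_{z\in{\mathfrak o}}\int_{x\in{\mathfrak o}}\int_{b\in{\mathfrak o}^\times}\int_{a\in{\mathfrak o}^\times}\chi(ab)\pi(t_4L(x)n(a,b,z\varpi^{-3}))\pi(\tau)v\,+\,q^2\int_{z\in{\mathfrak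 o}}\int_{y\in\mathfrak p}\int_{b\in{\mathfrak o}^\times}\int_{a\in{\mathfrak o}^\times}\chi(ab)\pi(t_4s_1L(y)n(a,b,z\varpi^{-3}))\pi(\tau)v$. *)

(* Defs.v *)
From HB Require Import structures.
From mathcomp Require Import all_boot all_order all_algebra.
From Stdlib Require Import ClassicalEpsilon.
Import Order.TTheory GRing.Theory Num.Theory.
Local Open Scope ring_scope.

Section Setting.

Variables (F : fieldType) (vo : F -> int) (w : F).
(* vo : normalized discrete valuation (its value at 0 is irrelevant),
   w : uniformizer *)

Definition inp (n : int) (x : F) : bool := (x == 0) || (n <= vo x).
Definition ino (x : F) : bool := inp 0 x.
Definition isunit (x : F) : bool := (x != 0) && (vo x == 0).
Definition unit_not1 (x : F) : bool := isunit x && ~~ inp 1 (x - 1).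

Record local_field (q : nat) (R : seq F) : Prop := {
  lf_char0 : forall n : nat, (n%:R : F) = 0 -> n = 0%N;
  lf_vM : forall x y, x != 0 -> y != 0 -> vo (x * y) = vo x + vo y;
  lf_vD : forall x y, x != 0 -> y != 0 -> x + y != 0 ->
            (vo x <= vo (x + y)) || (vo y <= vo (x + y));
  lf_unif : w != 0 /\ vo w = 1;
  lf_Runiq : uniq R;
  lf_Rsize : size R = q;
  lf_Ro : all ino R;
  lf_Rrep : forall x, ino x -> exists2 r, r \in R & inp 1 (x - r);
  lf_Rdist : forall r s, r \in R -> s \in R -> inp 1 (r - s) -> r = s;
  lf_complete : forall u : nat -> F,
      (forall k : nat, exists N : nat, forall m n : nat, (N <= m)%N -> (N <= n)%N ->
          inp k%:Z (u m - u n)) ->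
      exists l : F, forall k : nat, exists N : nat, forall n : nat, (N <= n)%N ->
          inp k%:Z (u n - l)
}.

(* representatives of o / p^N built from R:  sum_{i<N} r_i w^i *)
Fixpoint reps (R : seq F) (N : nat) : seq F :=
  match N with
  | 0 => [:: 0]
  | N'.+1 => [seq r + w * s | r <- R, s <- reps R N']
  end.

Definition mk4 (rows : seq (seq F)) : 'M[F]_4 :=
  \matrix_(i < 4, j < 4) nth 0 (nth [::] rows i) j.

Definition Jp : 'M[F]_4 :=
  mk4 [:: [:: 0; 0; 0; 1]; [:: 0; 0; 1; 0]; [:: 0; -1; 0; 0]; [:: -1; 0; 0; 0]].

Definition gsp4 (g : 'M[F]_4) : Prop :=
  exists l : F, l != 0 /\ g^T *m Jp *m g = l *: Jp.

Definition expo (n : nat) (i j : 'I_4) : int :=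
  if ((i : nat) == 0%N) && ((j : nat) == 3%N) then - (n%:Z)
  else if ((j : nat) == 0%N) && ((i : nat) != 0%N) then n%:Z
  else if ((i : nat) == 3%N) && ((j : nat) != 3%N) then n%:Z
  else 0.

Definition inKpara (n : nat) (k : 'M[F]_4) : Prop :=
  exists l : F, isunit l /\ k^T *m Jp *m k = l *: Jp /\
    (forall i j, inp (expo n i j) (k i j)).

Definition eta : 'M[F]_4 :=
  mk4 [:: [:: w^-1; 0; 0; 0]; [:: 0; 1; 0; 0]; [:: 0; 0; 1; 0]; [:: 0; 0; 0; w]].
Definition tau : 'M[F]_4 :=
  mk4 [:: [:: 1; 0; 0; 0]; [:: 0; w^-1; 0; 0]; [:: 0; 0; w; 0]; [:: 0; 0; 0; 1]].
Definition taui : 'M[F]_4 :=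
  mk4 [:: [:: 1; 0; 0; 0]; [:: 0; w; 0; 0]; [:: 0; 0; w^-1; 0]; [:: 0; 0; 0; 1]].
Definition t4 : 'M[F]_4 :=
  mk4 [:: [:: 0; 0; 0; - w ^- 4]; [:: 0; 1; 0; 0]; [:: 0; 0; 1; 0]; [:: w ^+ 4; 0; 0; 0]].
Definition s1 : 'M[F]_4 :=
  mk4 [:: [:: 1; 0; 0; 0]; [:: 0; 0; 1; 0]; [:: 0; -1; 0; 0]; [:: 0; 0; 0; 1]].
Definition Lm (x : F) : 'M[F]_4 :=
  mk4 [:: [:: 1; 0; 0; 0]; [:: 0; 1; 0; 0]; [:: 0; x; 1; 0]; [:: 0; 0; 0; 1]].
Definition nm (a b c : F) : 'M[F]_4 :=
  mk4 [:: [:: 1; - a * w^-1; b * w ^- 2; c]; [:: 0; 1; 0; b * w ^- 2];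
          [:: 0; 0; 1; a * w^-1]; [:: 0; 0; 0; 1]].
Definition Xm (s : F) : 'M[F]_4 :=
  mk4 [:: [:: 1; s; 0; 0]; [:: 0; 1; 0; 0]; [:: 0; 0; 1; - s]; [:: 0; 0; 0; 1]].
Definition Ym (r s t : F) : 'M[F]_4 :=
  mk4 [:: [:: 1; 0; r; s]; [:: 0; 1; t; r]; [:: 0; 0; 1; 0]; [:: 0; 0; 0; 1]].

Variables (K : numClosedFieldType) (V : lmodType K).

(* (pi, V): smooth representation of GSp(4,F) with trivial central
   character; pi is only meaningful on GSp(4,F). *)
Record smooth_rep (pi : 'M[F]_4 -> V -> V) : Prop := {
  rep_linear : forall g (a : K) (u u' : V), pi g (a *: u + u') = a *: pi g u + pi g u';
  rep_one : forall u, pi 1%:M u = u;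
  rep_mul : forall g h u, gsp4 g -> gsp4 h -> pi (g *m h) u = pi g (pi h u);
  rep_center : forall (c : F) u, c != 0 -> pi c%:M u = u;
  rep_smooth : forall u, exists n : nat, forall k, gsp4 k ->
      (forall i j, inp n%:Z (k i j - (1%:M : 'M[F]_4) i j)) -> pi k u = u
}.

Record quad_char_cond_p (chi : F -> K) : Prop := {
  ch_mul : forall x y, x != 0 -> y != 0 -> chi (x * y) = chi x * chi y;
  ch_sq : forall x, x != 0 -> chi x ^+ 2 = 1;
  ch_1p : forall y, inp 1 y -> chi (1 + y) = 1;
  ch_ram : exists2 u, isunit u & chi u != 1
}.

Definition inV0 (pi : 'M[F]_4 -> V -> V) (v : V) : Prop :=
  forall k, inKpara 0 k -> pi k v = v.

(* ---------- integration (Haar measure, vol(o) = 1) ---------- *)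
Variables (q : nat) (R : seq F).

Definition good (S : pred F) (f : F -> V) (N : nat) : Prop :=
  forall x y, S x -> inp N%:Z (y - x) -> S y /\ f y = f x.

(* integral over S (a compact open subset of o) of a locally constant f *)
Definition integ (S : pred F) (f : F -> V) : V :=
  match excluded_middle_informative (exists N, good S f N) with
  | left H =>
      let N := proj1_sig (constructive_indefinite_description _ H) in
      ((q%:R : K) ^- N) *: \sum_(r <- reps R N | S r) f r
  | right _ => 0
  end.

Definition intO := integ ino.
Definition intU := integ isunit.
Definition intP := integ (inp 1).
Definition intU1 := integ unit_not1.

Variables (chi : F -> K) (pi : 'M[F]_4 -> V -> V).

Definition Qk : K := q%:R.

Definition Tchi (v : V) : V :=
    Qk ^+ 3 *: intO (fun z => intO (fun x => intU (fun b => intU (fun a =>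
       chi (a * b) *: pi (Lm x *m nm a b (z * w ^- 4)) (pi tau v)))))
  + Qk ^+ 3 *: intO (fun z => intP (fun y => intU (fun b => intU (fun a =>
       chi (a * b) *: pi (s1 *m Lm y *m nm a b (z * w ^- 4)) (pi tau v)))))
  + Qk ^+ 2 *: intO (fun z => intO (fun x => intU (fun b => intU (fun a =>
       chi (a * b) *: pi (t4 *m Lm x *m nm a b (z * w ^- 3)) (pi tau v)))))
  + Qk ^+ 2 *: intO (fun z => intP (fun y => intU (fun b => intU (fun a =>
       chi (a * b) *: pi (t4 *m s1 *m Lm y *m nm a b (z * w ^- 3)) (pi tau v))))).

Definition T1 (v : V) : V :=
  Qk ^+ 2 *: intO (fun z => intU (fun x => intU (fun b => intU (fun a =>
    chi (a * b) *: pi (Xm (- (a + x * b) * w^-1) *m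
                       Ym (b * w ^- 2) (z * w ^- 4) (x^-1 * w^-1)) v)))).

Definition T2 (v : V) : V :=
  Qk *: pi eta (intU1 (fun y => intU (fun b => intU (fun a => intU1 (fun x =>
    chi (a * b * x * y) *: pi (Xm (b * w^-1) *m
      Ym (- a * w ^- 2) (a * b * (1 - (1 - y)^-1 * x) * w ^- 3)
         (a * b^-1 * (1 - x)^-1 * w^-1)) v))))).

Definition T3 (v : V) : V :=
  pi eta (intU1 (fun z => intU (fun b => intU (fun a =>
    chi (b * (1 - z)) *: pi (Ym (a * w ^- 2) (b * w ^- 3) (a ^+ 2 * b^-1 * z * w^-1)) v)))).

Definition T4 (v : V) : V :=
  Qk *: pi eta (intU (fun x => intU (fun b => intO (fun a =>
    chi b *: pi (Xm (x * w ^- 2) *m Ym (a * w ^- 2) ((b * w - a * x) * w ^- 4) 0) v)))).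

Definition T5 (v : V) : V :=
  pi eta (intO (fun x => intU (fun b => intU (fun a =>
    chi b *: pi (Xm (x * w^-1) *m Ym (a * w ^- 2) ((b - a * x) * w ^- 3) 0) v)))).

Definition T6 (v : V) : V :=
  Qk^-1 *: pi eta (pi eta (intU (fun x => intU (fun b => intU (fun a =>
    chi (b * x) *: pi (Ym (a * w ^- 2) (b * (1 - x * w) * w ^- 2) (a ^+ 2 * b^-1 * w ^- 2)) v))))).

Definition T7 (v : V) : V :=
  Qk *: pi tau (intO (fun z => intU (fun b => intU (fun a =>
    chi (a * b) *: pi (Xm (- a * w ^- 2) *m Ym (b * w^-1) (z * w ^- 4) 0) v)))).

Definition T8 (v : V) : V :=
  pi eta (pi tau (intU1 (fun z => intU (fun b => intU (fun a =>
    chi (a * b * z * (1 - z)) *: pi (Xm (b * w ^- 2) *m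
       Ym (a * w^-1) (- (a * b * (1 - z)) * w ^- 3) 0) v))))).

Definition T9 (v : V) : V :=
  Qk ^- 2 *: pi eta (pi eta (pi tau (intU (fun x => intU (fun b => intU (fun a =>
    chi b *: pi (Xm (a * w^-1) *m Ym 0 (- b * w^-1) (x * w^-1)) v)))))).

Definition T10 (v : V) : V :=
  Qk ^- 3 *: pi eta (pi eta (pi tau (pi tau (intU (fun b => intU (fun a =>
    chi b *: pi (Xm (a * w ^- 2) *m Ym 0 (- b * w^-1) 0) v)))))).

Definition T11 (v : V) : V :=
  Qk ^+ 3 *: pi taui (intO (fun z => intO (fun x => intU (fun b => intU (fun a =>
    chi (a * b) *: pi (Xm (b * w^-1) *m
       Ym ((x * b + a * w) * w ^- 3) (z * w ^- 4) (- x * w ^- 2)) v))))).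

Definition T12 (v : V) : V :=
  Qk ^+ 2 *: pi eta (pi taui (intU1 (fun z => intO (fun y => intU (fun b => intU (fun a =>
    chi (a * b * z * (1 - z)) *: pi (Xm (a * w^-1) *m
       Ym (y * w ^- 3) (a * (b * (1 - z) * w - y) * w ^- 4)
          (- (a^-1 * (y + b * w)) * w ^- 2)) v)))))).

Definition T13 (v : V) : V :=
  pi eta (pi eta (pi taui (intU (fun x => intU (fun b => intU (fun a =>
    chi (b * x) *: pi (Ym (a * w ^- 2) (b * (1 - x) * w^-1) (a ^+ 2 * b^-1 * w ^- 3)) v)))))).

Definition T14 (v : V) : V :=
  Qk *: pi eta (pi eta (pi taui (pi taui (intO (fun x => intU (fun b => intU (fun a =>
    chi b *: pi (Ym (a * w ^- 2) (- b * w^-1) (x * w ^- 4)) v))))))).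

Definition Tk (k : nat) (v : V) : V :=
  match k with
  | 1 => T1 v | 2 => T2 v | 3 => T3 v | 4 => T4 v | 5 => T5 v
  | 6 => T6 v | 7 => T7 v | 8 => T8 v | 9 => T9 v | 10 => T10 v
  | 11 => T11 v | 12 => T12 v | 13 => T13 v | 14 => T14 v
  | _ => 0
  end.

End Setting.

(* Main.v *)
(** Both sides are finite combinations of vectors pi(g) v, and pi(g) v depends only
    on the coset of g modulo GSp(4,o). Write H(l,m,k) for the Heisenberg element
    with first row (1,l,m,k); every coset is represented by diag(d1,d2,1/d2,1/d1) H(l,m,k)
    Y(0,0,t), and X(s)Y(r,s',t) = H(s,r,s'+sr)Y(0,0,t). The Iwasawa decomposition
    of L(x) yields T^7, T^1, T^11 from the first two terms of the operator, for v(x) >= 2,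
    v(x) = 1 and v(x) = 0 (joined with the second term) respectively. The last two terms
    are the image under t_4 of the same three pieces with z varpi^(-3) instead of
    z varpi^(-4); the Iwasawa decomposition of t_4 H(l,m,k) depends on whether z and
    certain polynomials in (z,x,b,a), such as z+ab, a+xb and xz+a(a+xb), are
    units, and each of the resulting regions is carried by a measure
    preserving change of variables onto (part of) the domain of one of the remaining T^k. *)

Require Import Defs.
From HB Require Import structures.
From mathcomp Require Import all_boot all_order all_algebra.
From mathcomp Require Import ssrAC zify ring.
From Stdlib Require Import ClassicalEpsilon.
Import Order.TTheory GRing.Theory Num.Theory.
Local Open Scope ring_scope.

Set Implicit Arguments.
Unset Strict Implicit.
Unset Printing Implicit Defensive.

(** The group computations are identities between rational functions; the obstacle is the
    integration. An integral is a finite sum over representatives of o/p^N, and a substitution sends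
    a representative only to a point congruent to one. All integrals are therefore moved to the
    common level 20, and [lip] records congruence together with the digits lost: each factor w^-1
    costs one. The denominators that occur cost at most six, so every final error is integral and is
    absorbed by the fixed vector v. A substitution is then admissible as soon as it and its inverse
    preserve congruence, and no Jacobian is computed. The regions are four-dimensional, while many
    T^k have only two or three variables. The missing coordinates become dummy variables in p: they
    are quantities required to lie in p (x, z, z+ab, a+xb or xz+a(a+xb)) on which the coset no
    longer depends. The characters on both sides are compared through the triviality of chi on
    squares of units and on 1+p. *)

Section Twist.

#[local] Arguments Defs.isunit : simpl never.
#[local] Arguments Defs.inp : simpl never.
#[local] Arguments Defs.ino : simpl never.
#[local] Arguments Defs.unit_not1 : simpl never.

Variables (F : fieldType) (vo : F -> int) (w : F) (q : nat) (R : seq F).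
Hypothesis hF : local_field F vo w q R.

Local Notation inp := (inp F vo).
Local Notation ino := (ino F vo).
Local Notation isunit := (isunit F vo).

(** * Valuations *)

Lemma w_neq0 : w != 0. Proof. by case: (lf_unif _ _ _ _ _ hF). Qed.

Lemma vo1 : vo 1 = 0.
Proof.
have := lf_vM _ _ _ _ _ hF 1 1 (oner_neq0 _) (oner_neq0 _).
by rewrite mulr1; lia.
Qed.

Lemma voN1 : vo (-1) = 0.
Proof.
have n0 : (-1 : F) != 0 by rewrite oppr_eq0 oner_neq0.
have := lf_vM _ _ _ _ _ hF (-1) (-1) n0 n0.
by rewrite mulrNN mulr1 vo1; lia.
Qed.

Lemma voV x : x != 0 -> vo x^-1 = - vo x.
Proof.
move=> x0; have := lf_vM _ _ _ _ _ hF x x^-1 x0.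
by rewrite invr_eq0 divff // vo1 => /(_ x0); lia.
Qed.

Lemma vow : vo w = 1. Proof. by case: (lf_unif _ _ _ _ _ hF). Qed.

Lemma voX n : vo (w ^+ n) = n%:Z.
Proof.
elim: n => [|n IH]; first by rewrite expr0 vo1.
by rewrite exprS (lf_vM _ _ _ _ _ hF) ?expf_neq0 ?w_neq0 // vow IH; lia.
Qed.

Lemma inp0 n : inp n 0. Proof. by rewrite /Defs.inp eqxx. Qed.

Lemma inpM m n x y : inp m x -> inp n y -> inp (m + n) (x * y).
Proof.
rewrite /Defs.inp mulf_eq0; case: eqVneq => //= x0; case: eqVneq => //= y0.
by rewrite (lf_vM _ _ _ _ _ hF) //; exact: lerD.
Qed.

Lemma inpD n x y : inp n x -> inp n y -> inp n (x + y).
Proof.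
rewrite /Defs.inp; case: (eqVneq x 0) => [->|x0]; first by rewrite add0r.
case: (eqVneq y 0) => [->|y0]; first by rewrite addr0 (negPf x0).
case: (eqVneq (x + y) 0) => //= xy0 hx hy.
by case/orP: (lf_vD _ _ _ _ _ hF x y x0 y0 xy0); apply: le_trans.
Qed.

Lemma inpN n x : inp n x -> inp n (- x).
Proof.
rewrite /Defs.inp oppr_eq0; case: eqVneq => //= x0.
by rewrite -mulN1r (lf_vM _ _ _ _ _ hF) ?voN1 ?oppr_eq0 ?oner_neq0 //; lia.
Qed.

Lemma inpB n x y : inp n x -> inp n y -> inp n (x - y).
Proof. by move=> hx hy; apply: inpD => //; apply: inpN. Qed.

Lemma inp_sub n m x : m <= n -> inp n x -> inp m x.
Proof. by rewrite /Defs.inp; case: eqP => //= _; lia. Qed.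

Lemma inpX n : inp n%:Z (w ^+ n).
Proof. by rewrite /Defs.inp voX lexx orbT. Qed.

Lemma inpXV n : inp (- n%:Z) (w ^- n).
Proof. by rewrite /Defs.inp voV ?voX ?lexx ?orbT // expf_neq0 // w_neq0. Qed.

Lemma inp_divX n (m : int) x : inp m (w ^+ n * x) = inp (m - n%:Z) x.
Proof.
rewrite /Defs.inp mulf_eq0 expf_eq0 (negPf w_neq0) andbF /=.
case: eqVneq => //= x0; rewrite (lf_vM _ _ _ _ _ hF) ?expf_neq0 ?w_neq0 // voX.
lia.
Qed.

Lemma inp1w x : inp 1 (w * x) = ino x.
Proof. by have := inp_divX 1 1 x; rewrite expr1. Qed.

Lemma inp1_ino x : inp 1 x -> ino x. Proof. exact: inp_sub. Qed.

Lemma unit_ino x : isunit x -> ino x.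
Proof. by rewrite /Defs.isunit /Defs.ino /Defs.inp => /andP[_ /eqP->]; rewrite lexx orbT. Qed.

Lemma unit_neq0 x : isunit x -> x != 0. Proof. by case/andP. Qed.

Lemma unitE x : isunit x = ino x && ~~ inp 1 x.
Proof.
rewrite /Defs.isunit /Defs.ino /Defs.inp; case: eqVneq => //= _; lia.
Qed.

Lemma unit_notp x : isunit x -> ~~ inp 1 x. Proof. by rewrite unitE => /andP[]. Qed.

Lemma ino_unit x : ino x -> ~~ inp 1 x -> isunit x.
Proof. by rewrite unitE => -> ->. Qed.

Lemma unitM x y : isunit x -> isunit y -> isunit (x * y).
Proof.
rewrite /Defs.isunit mulf_eq0 => /andP[x0 /eqP vx] /andP[y0 /eqP vy].
by rewrite negb_or x0 y0 (lf_vM _ _ _ _ _ hF) // vx vy.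
Qed.

Lemma unitV x : isunit x -> isunit x^-1.
Proof. by rewrite /Defs.isunit => /andP[x0 /eqP vx]; rewrite invr_eq0 x0 voV // vx. Qed.

Lemma unitN x : isunit x -> isunit (- x).
Proof.
rewrite !unitE /Defs.ino => /andP[hx nx]; rewrite inpN //=.
by apply: contra nx => /inpN; rewrite opprK.
Qed.

Lemma unit1 : isunit 1. Proof. by rewrite /Defs.isunit oner_neq0 vo1. Qed.

Lemma unitDp x y : isunit x -> inp 1 y -> isunit (x + y).
Proof.
rewrite !unitE => /andP[hx nx] hy; rewrite /Defs.ino inpD //; last exact: inp1_ino.
by apply: contra nx => h; rewrite -(addrK y x); apply: inpB.
Qed.

Lemma unitpD x y : inp 1 x -> isunit y -> isunit (x + y).
Proof. by move=> hx hy; rewrite addrC; apply: unitDp. Qed.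

Lemma unitX x n : isunit x -> isunit (x ^+ n).
Proof.
move=> ux; elim: n => [|n IH]; first by rewrite expr0 unit1.
by rewrite exprS unitM.
Qed.

Lemma inoM x y : ino x -> ino y -> ino (x * y). Proof. exact: inpM. Qed.
Lemma inoD x y : ino x -> ino y -> ino (x + y). Proof. exact: inpD. Qed.
Lemma inoN x : ino x -> ino (- x). Proof. exact: inpN. Qed.
Lemma inoX x n : ino x -> ino (x ^+ n).
Proof.
move=> ux; elim: n => [|n IH]; first by rewrite expr0 unit_ino // unit1.
by rewrite exprS inoM.
Qed.
Lemma ino0 : ino 0. Proof. exact: inp0. Qed.
Lemma ino1 : ino 1. Proof. exact: unit_ino unit1. Qed.
Lemma inow : ino w. Proof. by rewrite /Defs.ino /Defs.inp vow orbT. Qed.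
Lemma inp1w1 : inp 1 w. Proof. by rewrite /Defs.inp vow orbT. Qed.
Lemma inp1Ml x y : inp 1 x -> ino y -> inp 1 (x * y).
Proof. by move=> hx hy; have := inpM hx hy; rewrite addr0. Qed.
Lemma inp1Mr x y : ino x -> inp 1 y -> inp 1 (x * y).
Proof. by move=> hx hy; have := inpM hx hy; rewrite add0r. Qed.
Lemma inp1X x n : inp 1 x -> inp 1 (x ^+ n.+1).
Proof. by move=> hx; rewrite exprS inp1Ml // inoX // inp1_ino. Qed.
Lemma inoNat n : ino n%:R.
Proof. by elim: n => [|n IH]; [exact: inp0 | rewrite mulrS inoD // ino1]. Qed.

(* x and y have size at most q^i and are congruent modulo p^(20-i); the level
   20 is a convenient bound for every modulus occurring below. *)
Definition lip (i : nat) (x y : F) : bool :=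
  [&& inp (- i%:Z) x, inp (- i%:Z) y & inp (20%:Z - i%:Z) (x - y)].

Lemma lip_le i j x y : (i <= j)%N -> lip i x y -> lip j x y.
Proof.
by move=> ij /and3P[h1 h2 h3]; rewrite /lip (inp_sub _ h1) ?(inp_sub _ h2) ?(inp_sub _ h3) //; lia.
Qed.

Lemma lipD i j x y x' y' : lip i x y -> lip j x' y' -> lip (maxn i j) (x + x') (y + y').
Proof.
move=> /(lip_le (leq_maxl i j))/and3P[h1 h2 h3] /(lip_le (leq_maxr i j))/and3P[k1 k2 k3].
apply/and3P; split; try exact: inpD.
by have -> : x + x' - (y + y') = (x - y) + (x' - y') by [ring]; apply: inpD.
Qed.

Lemma lipN i x y : lip i x y -> lip i (- x) (- y).
Proof.
case/and3P => h1 h2 h3; apply/and3P; split; try exact: inpN.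
by have -> : - x - - y = - (x - y) by [ring]; apply: inpN.
Qed.

Lemma lipM i j x y x' y' : lip i x y -> lip j x' y' -> lip (i + j) (x * x') (y * y').
Proof.
move=> /and3P[h1 h2 h3] /and3P[k1 k2 k3].
rewrite /lip PoszD opprD (inpM h1 k1) (inpM h2 k2) /=.
have -> : x * x' - y * y' = (x - y) * x' + y * (x' - y') by ring.
by apply: inpD; [apply: inp_sub (inpM h3 k1)|apply: inp_sub (inpM h2 k3)]; rewrite -?opprD; lia.
Qed.

(** Inverting units costs no digit, since 1/x - 1/y = -(x - y)/(xy). *)
Lemma lipV i x y : isunit x -> isunit y -> lip i x y -> lip i x^-1 y^-1.
Proof.
move=> ux uy /and3P[h1 h2 h3].
have vx := unit_ino (unitV ux); have vy := unit_ino (unitV uy).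
apply/and3P; split; [by apply: inp_sub vx; lia | by apply: inp_sub vy; lia |].
have -> : x^-1 - y^-1 = - (x^-1 * y^-1 * (x - y)).
  by field; rewrite (unit_neq0 ux) (unit_neq0 uy).
by apply: inpN; have := inpM (inoM vx vy) h3; rewrite add0r.
Qed.

Lemma lip_refl i x : inp (- i%:Z) x -> lip i x x.
Proof. by move=> h; rewrite /lip h subrr inp0. Qed.
Lemma lip_w : lip 0 w w. Proof. exact/lip_refl/inow. Qed.
Lemma lip_wV : lip 1 w^-1 w^-1. Proof. by apply: lip_refl; have := inpXV 1; rewrite expr1. Qed.
Lemma lip_wXV n : lip n (w ^- n) (w ^- n). Proof. exact/lip_refl/inpXV. Qed.
Lemma lip_1 : lip 0 1 1. Proof. exact/lip_refl/ino1. Qed.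
Lemma lip_0 : lip 0 0 0. Proof. exact/lip_refl/inp0. Qed.

Lemma lipX i x y n : lip i x y -> lip (n * i) (x ^+ n) (y ^+ n).
Proof.
move=> h; elim: n => [|n IH]; first by rewrite !expr0 lip_1.
by rewrite !exprS mulSn lipM.
Qed.

Lemma lip_inp (i : nat) (n : int) x y :
  (n <= 20%:Z - i%:Z) -> inp n x -> lip i x y -> inp n y.
Proof.
move=> hn hx /and3P[_ _ h]; rewrite -(subKr x y).
by apply: inpB => //; apply: inp_sub h.
Qed.

Lemma lip_sym i x y : lip i x y -> lip i y x.
Proof. by case/and3P => h1 h2 h3; rewrite /lip h1 h2 -(opprB x y) inpN. Qed.

Lemma lip_trans i x y z : lip i x y -> lip i y z -> lip i x z.
Proof.
case/and3P => h1 h2 h3 /and3P[h4 h5 h6]; rewrite /lip h1 h5.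
by have -> : x - z = (x - y) + (y - z) by [ring]; rewrite inpD.
Qed.

Lemma lip_unit x y : isunit x -> lip 0 x y -> isunit y.
Proof.
rewrite !unitE => /andP[hx nx] h; apply/andP; split; first exact: lip_inp hx h.
by apply: contra nx => hy; apply: lip_inp hy (lip_sym h).
Qed.

Lemma inp1_div x : inp 1 x -> ino (x / w).
Proof. by move=> h; have := inpM h (inpXV 1); rewrite expr1. Qed.

(** * Integrals *)

Local Notation reps := (reps F w R).
(* Locked, so that no conversion unfolds the list [reps lev]. *)
Definition lev : nat := locked 20%N.
Lemma levE : lev = 20%N. Proof. by rewrite /lev -lock. Qed.

Lemma repsS N : reps N.+1 = [seq r + w * s | r <- R, s <- reps N]. Proof. by []. Qed.

Lemma R_ino r : r \in R -> ino r. Proof. exact: (allP (lf_Ro _ _ _ _ _ hF)). Qed.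

Lemma reps_ino N x : x \in reps N -> ino x.
Proof.
elim: N x => [|N IH] x; first by rewrite inE => /eqP->; exact: inp0.
rewrite repsS => /allpairsP[[r s] /= [hr hs ->]].
by apply: inoD; [exact: R_ino | apply: inoM; [exact: inow | exact: IH]].
Qed.

Lemma reps_exists N x : ino x -> exists2 r, r \in reps N & inp N%:Z (x - r).
Proof.
elim: N x => [|N IH] x hx; first by exists 0; rewrite ?inE // subr0.
have [r hr hxr] := lf_Rrep _ _ _ _ _ hF x hx.
have [s hs hxs] := IH ((x - r) / w) (inp1_div hxr).
exists (r + w * s); first by rewrite repsS; apply: allpairs_f.
have -> : x - (r + w * s) = w ^+ 1 * ((x - r) / w - s).
  by rewrite expr1; field; rewrite w_neq0.
by rewrite inp_divX; apply: inp_sub hxs; lia.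
Qed.

Lemma reps_dist N x y : x \in reps N -> y \in reps N -> inp N%:Z (x - y) -> x = y.
Proof.
elim: N x y => [|N IH] x y; first by rewrite !inE => /eqP-> /eqP->.
rewrite repsS => /allpairsP[[r s] /= [hr hs ->]] /allpairsP[[r' s'] /= [hr' hs' ->]] h.
have err' : r = r'.
  apply: (lf_Rdist _ _ _ _ _ hF) => //.
  have -> : r - r' = (r + w * s - (r' + w * s')) - w * (s - s') by ring.
  apply: inpB; first by apply: inp_sub h; lia.
  by rewrite inp1w; apply: inpB; apply: reps_ino; eassumption.
rewrite err' in h *; congr (_ + w * _); apply: IH => //.
move: h; have -> : r' + w * s - (r' + w * s') = w ^+ 1 * (s - s') by ring.
by rewrite inp_divX; apply: inp_sub; lia.
Qed.

Lemma reps_uniq N : uniq (reps N).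
Proof.
elim: N => [|N IH] //; rewrite repsS allpairs_uniq ?(lf_Runiq _ _ _ _ _ hF) //.
move=> [r s] [r' s'] /allpairsP[[r1 s1] /= [hr hs [-> ->]]].
move=> /allpairsP[[r2 s2] /= [hr' hs' [-> ->]]] h.
have err' : r1 = r2.
  apply: (lf_Rdist _ _ _ _ _ hF) => //.
  have -> : r1 - r2 = w * (s2 - s1) by rewrite -[r1](addrK (w * s1)) h; ring.
  by rewrite inp1w; apply: inpB; apply: reps_ino; eassumption.
move: h; rewrite err' => /addrI /(mulfI w_neq0) ->.
by [].
Qed.

Variables (K : numClosedFieldType) (V : lmodType K).

Local Notation Q := (q%:R : K).

Lemma Q_neq0 : Q != 0.
Proof.
rewrite pnatr_eq0 -(lf_Rsize _ _ _ _ _ hF) size_eq0.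
by have [r + _] := lf_Rrep _ _ _ _ _ hF 0 (inp0 _); case: (R).
Qed.

(** [reps] recurses on the lowest digit, while refining level N to N+1 appends a highest digit; this
    reconciles the two. *)
Lemma sum_repsS N (f : F -> V) :
  \sum_(x <- reps N.+1) f x = \sum_(x <- reps N) \sum_(r <- R) f (x + w ^+ N * r).
Proof.
elim: N f => [|N IH] f.
  rewrite repsS big_allpairs_dep big_seq1 /=; apply: eq_bigr => r _.
  by rewrite big_seq1 mulr0 addr0 add0r mul1r.
rewrite repsS big_allpairs_dep [in RHS]repsS big_allpairs_dep; apply: eq_bigr => r _.
rewrite IH; apply: eq_bigr => s _; apply: eq_bigr => r' _; congr f.
by rewrite exprS; ring.
Qed.

Definition mean N (S : pred F) (f : F -> V) : V := Q ^- N *: \sum_(x <- reps N | S x) f x.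

(** Each class modulo p^M splits into q classes modulo p^(M+1) on which S and f do not vary; this q
    cancels the change of normalisation. *)
Lemma mean_good M N S (f : F -> V) : good F vo K V S f N -> (N <= M)%N -> mean M S f = mean N S f.
Proof.
move=> hg; elim: M => [|M IH]; first by rewrite leqn0 => /eqP->.
rewrite leq_eqVlt => /predU1P[<-//|]; rewrite ltnS => NM.
rewrite -(IH NM) /mean big_mkcond /= sum_repsS [in RHS]big_mkcond exprSr invfM -scalerA; congr (_ *: _).
rewrite scaler_sumr big_seq [RHS]big_seq; apply: eq_bigr => x hx.
rewrite (eq_big_seq (fun=> if S x then f x else 0)) => [|r hr]; last first.
  have hd : inp N%:Z (x + w ^+ M * r - x).
    rewrite addrC addKr; apply: inp_sub (inpM (inpX M) (R_ino hr)); lia.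
  (* [good] transports membership in S in one direction, so both differences are needed to compare
     the two points. *)
  have hd' : inp N%:Z (x - (x + w ^+ M * r)) by rewrite -opprB inpN.
  case: ifP => [h|/negP h]; case: ifP => [h'|/negP h'] //.
  - by case: (hg _ _ h' hd).
  - by case: (hg _ _ h hd') => /h'.
  - by case: (hg _ _ h' hd) => /h.
by rewrite big_const_seq count_predT (lf_Rsize _ _ _ _ _ hF) iter_addr addr0 -scaler_nat scalerA mulVf ?scale1r ?Q_neq0.
Qed.

Definition E1 := mean lev.

(** The level used by [integ] comes from a choice principle and is unknown; any two good levels are
    comparable and hence give the same mean. *)
Lemma integ_good S (f : F -> V) : good F vo K V S f lev -> integ F vo w K V q R S f = E1 S f.
Proof.
move=> hg; rewrite /integ; case: excluded_middle_informative => [H|[]]; last by exists lev.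
case: (constructive_indefinite_description _ _) => N hN /=.
rewrite -[LHS]/(mean N S f) /E1.
by case/orP: (leq_total N lev) => h; [rewrite (mean_good hN h)|rewrite (mean_good hg h)].
Qed.

(** Reindexing along a relation instead of a map, because the image of a representative is congruent
    to a representative but need not be one. The induction removes one matched pair at a time. *)
Lemma sum_match (X Y : eqType) (s : seq X) (t : seq Y) (m : X -> Y -> bool)
    (f : X -> V) (g : Y -> V) :
  uniq s -> uniq t ->
  (forall x, x \in s -> exists2 y, y \in t & m x y) ->
  (forall y, y \in t -> exists2 x, x \in s & m x y) ->
  (forall x y y', x \in s -> y \in t -> y' \in t -> m x y -> m x y' -> y = y') ->
  (forall x x' y, x \in s -> x' \in s -> y \in t -> m x y -> m x' y -> x = x') ->
  (forall x y, x \in s -> y \in t -> m x y -> f x = g y) ->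
  \sum_(x <- s) f x = \sum_(y <- t) g y.
Proof.
elim: s t => [|x s IH] t us ut hs ht hy hx hfg.
  case: t ut ht hs hy hx hfg => [|y t] _ ht _ _ _ _; first by rewrite !big_nil.
  by case: (ht y (mem_head _ _)).
have [y yt mxy] := hs x (mem_head _ _).
rewrite big_cons (perm_big _ (perm_to_rem yt)) big_cons (hfg _ _ (mem_head _ _) yt mxy).
congr (_ + _); move: us => /= /andP[xs us].
have sub x' : x' \in s -> x' \in x :: s by move=> h; rewrite inE h orbT.
have rt y' : (y' \in rem y t) = (y' != y) && (y' \in t) by rewrite mem_rem_uniq.
apply: IH => //; first exact: rem_uniq.
- move=> x' hx'; have [y' yt' mx'] := hs _ (sub _ hx'); exists y' => //.
  rewrite rt yt' andbT; apply: contraNneq xs => e; rewrite e in mx'.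
  by rewrite (hx _ _ _ (mem_head _ _) (sub _ hx') yt mxy mx').
- move=> y'; rewrite rt => /andP[ny yt']; have [x' + mx'] := ht _ yt'.
  rewrite inE => /predU1P[e|]; last by exists x'.
  by rewrite e in mx'; rewrite (hy _ _ _ (mem_head _ _) yt yt' mxy mx') eqxx in ny.
- by move=> x' y1 y2 /sub h1; rewrite !rt => /andP[_ h2] /andP[_ h3]; apply: hy.
- by move=> x1 x2 y1 /sub h1 /sub h2; rewrite rt => /andP[_ h3]; apply: hx.
- by move=> x' y' /sub h1; rewrite rt => /andP[_ h2]; apply: hfg.
Qed.

Lemma cong_lip x y : ino x -> ino y -> inp lev%:Z (x - y) -> lip 0 x y.
Proof. by rewrite levE /lip => hx hy h; apply/and3P. Qed.

Lemma lip_cong x y : lip 0 x y -> inp lev%:Z (x - y). Proof. by rewrite levE => /and3P[]. Qed.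

Lemma reps_lip x : ino x -> exists2 r, r \in reps lev & lip 0 x r.
Proof.
by move=> hx; have [r hr h] := reps_exists lev hx; exists r => //; apply: cong_lip => //; apply: reps_ino hr.
Qed.

Lemma reps_lip_eq x y : x \in reps lev -> y \in reps lev -> lip 0 x y -> x = y.
Proof. by move=> hx hy /lip_cong; apply: reps_dist. Qed.

Lemma lip0_ino x y : lip 0 x y -> ino x * ino y.
Proof. by case/and3P => h1 h2 _. Qed.

Definition dom (S : pred F) : Prop :=
  (forall x, S x -> ino x) /\ (forall x y, S x -> lip 0 x y -> S y).

Lemma dom_o : dom ino. Proof. by split=> // x y _ /lip0_ino[]. Qed.
Lemma dom_U : dom isunit. Proof. by split=> [x /unit_ino|x y /lip_unit]; [|apply]. Qed.
Lemma lip_inp1 x y : inp 1 x -> lip 0 x y -> inp 1 y. Proof. exact: lip_inp. Qed.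
Lemma dom_p : dom (inp 1). Proof. by split=> [x /inp1_ino|x y /lip_inp1]; [|apply]. Qed.
Lemma dom_p2 : dom (inp 2).
Proof. by split=> [x|x y]; [apply: inp_sub | apply: lip_inp]. Qed.
Lemma dom_U1 : dom (unit_not1 F vo).
Proof.
split=> [x /andP[/unit_ino]//|x y /andP[ux nx] h]; rewrite /unit_not1 (lip_unit ux h) /=.
apply: contra nx => hy; apply: lip_inp1 hy _; apply: (@lipD 0 0); first exact: lip_sym.
exact: (@lipN 0 _ _ lip_1).
Qed.

(** Two functions occur because in an iterated integral the inner integrals must be rewritten, on S
    only, before the periodicity of the result is visible. *)
Lemma integ_E1 (S : pred F) (f g : F -> V) : dom S ->
  (forall x, S x -> f x = g x) ->
  (forall x y, S x -> S y -> lip 0 x y -> g x = g y) ->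
  integ F vo w K V q R S f = E1 S g.
Proof.
move=> [dS pS] fg per; rewrite integ_good => [|x y Sx h].
  rewrite /E1 /mean; congr (_ *: _); apply: eq_bigr => x; exact: fg.
have xy : lip 0 x y.
  apply: cong_lip; [exact: dS | | by rewrite -opprB inpN].
  by rewrite -(subrK x y) inoD //; [apply: inp_sub h | apply: dS].
have Sy := pS _ _ Sx xy; split=> //.
by rewrite !fg // (per _ _ Sx Sy xy).
Qed.

Lemma eq_E1 (S : pred F) (f g : F -> V) : (forall x, S x -> f x = g x) -> E1 S f = E1 S g.
Proof. by move=> h; congr (_ *: _); apply: eq_bigr. Qed.

Lemma E1Z c (S : pred F) (f : F -> V) : E1 S (fun x => c *: f x) = c *: E1 S f.
Proof. by rewrite /E1 /mean -scaler_sumr !scalerA mulrC. Qed.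

Lemma E1_mkcond (S : pred F) (f : F -> V) : E1 S f = E1 ino (fun x => if S x then f x else 0).
Proof.
congr (_ *: _); rewrite big_mkcond big_seq [RHS]big_seq_cond big_mkcondr.
by apply: eq_bigr => x /reps_ino ->.
Qed.

(** The class of w*x modulo p^20 determines x only modulo p^19. The right side is therefore computed
    at level 19, and the two normalisations differ by q. *)
Lemma E1_scale (f : F -> V) :
  (forall x y, inp 1 x -> inp 1 y -> lip 0 x y -> f x = f y) ->
  E1 (inp 1) f = Q^-1 *: E1 ino (fun x => f (w * x)).
Proof.
move=> per; have [M eM M19] : exists2 M, lev = M.+1 & M = 19%N by exists 19%N; rewrite ?levE.
have hg : good F vo K V ino (fun x => f (w * x)) M.
  move=> x y hx h; have hy : ino y by rewrite -(subrK x y) inoD //; apply: inp_sub h; lia.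
  split=> //; apply: per; rewrite ?inp1w //.
  apply: cong_lip; rewrite ?inoM ?inow // eM -mulrBr -[w]expr1 inp_divX.
  by apply: inp_sub h; lia.
rewrite /E1 (@mean_good lev M ino _ hg) ?eM // /mean scalerA -invfM -exprS -eM.
congr (_ *: _); rewrite -big_filter -[RHS]big_filter.
apply: (@sum_match _ _ _ _ (fun x y => lip 0 x (w * y))).
- exact/filter_uniq/reps_uniq.
- exact/filter_uniq/reps_uniq.
- move=> x; rewrite mem_filter => /andP[hx _].
  have [s hs h] := reps_exists M (inp1_div hx); exists s; first by rewrite mem_filter hs (reps_ino hs).
  apply: cong_lip; [exact: inp1_ino | exact: inoM inow (reps_ino hs) |].
  have -> : x - w * s = w ^+ 1 * (x / w - s) by rewrite expr1; field; rewrite w_neq0.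
  by rewrite eM inp_divX; apply: inp_sub h; lia.
- move=> y; rewrite mem_filter => /andP[hy _].
  have hwy : inp 1 (w * y) by rewrite inp1w.
  have [r hr h] := reps_lip (inp1_ino hwy); exists r; last exact: lip_sym.
  by rewrite mem_filter hr andbT; apply: lip_inp1 hwy h.
- move=> x y y' _; rewrite !mem_filter => /andP[_ hy] /andP[_ hy'] h h'.
  apply: reps_dist hy hy' _.
  have := lip_cong (lip_trans (lip_sym h) h').
  by rewrite eM -mulrBr -[w]expr1 inp_divX; apply: inp_sub; lia.
- move=> x x' y; rewrite !mem_filter => /andP[_ hx] /andP[_ hx'] _ h h'.
  by apply: reps_lip_eq => //; apply: lip_trans h (lip_sym h').
- move=> x y; rewrite !mem_filter => /andP[hx _] /andP[hy _].
  by apply: per; rewrite ?inp1w.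
Qed.

Lemma E1_const (u : V) : E1 ino (fun=> u) = u.
Proof.
have hg : good F vo K V ino (fun=> u) 0.
  by move=> x y hx h; split=> //; rewrite -(subrK x y) inoD.
by rewrite /E1 (mean_good hg) // /mean big_cons big_nil expr0 invr1 scale1r [ino 0]inp0 addr0.
Qed.

Lemma E1p_const (u : V) : E1 (inp 1) (fun=> u) = Q^-1 *: u.
Proof. by rewrite E1_scale // E1_const. Qed.

(** * Fourfold sums and substitutions *)

Local Notation pt := (F * F * F * F)%type.

Definition reps4 : seq pt :=
  [seq (p, a) | p <- [seq (p, b) | p <- [seq (z, x) | z <- reps lev, x <- reps lev],
                                   b <- reps lev], a <- reps lev].

Definition E4 (S : pred pt) (f : pt -> V) : V :=
  locked (Q ^- (lev * 4) *: \sum_(p <- reps4 | S p) f p).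

Definition ino4 (p : pt) : bool := let: (z, x, b, a) := p in [&& ino z, ino x, ino b & ino a].

Definition lip4 (p p' : pt) : bool :=
  let: (z, x, b, a) := p in let: (z', x', b', a') := p' in
  [&& lip 0 z z', lip 0 x x', lip 0 b b' & lip 0 a a'].

Lemma lip4_sym p p' : lip4 p p' -> lip4 p' p.
Proof.
case: p p' => [[[z x] b] a] [[[z' x'] b'] a'] /and4P[h1 h2 h3 h4].
by apply/and4P; split; apply: lip_sym.
Qed.

Lemma lip4_trans p p' p'' : lip4 p p' -> lip4 p' p'' -> lip4 p p''.
Proof.
case: p p' p'' => [[[z x] b] a] [[[z' x'] b'] a'] [[[z'' x''] b''] a''].
move=> /and4P[h1 h2 h3 h4] /and4P[k1 k2 k3 k4].
by apply/and4P; split; apply: lip_trans; eassumption.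
Qed.

Lemma mem_pairs (X Y : eqType) (s : seq X) (t : seq Y) x y :
  ((x, y) \in [seq (i, j) | i <- s, j <- t]) = (x \in s) && (y \in t).
Proof.
apply/allpairsP/andP => [[[i j] /= [hi hj [-> ->]]]//|[hx hy]].
by exists (x, y).
Qed.

Lemma mem_reps4 z x b a : ((z, x, b, a) \in reps4) =
  [&& z \in reps lev, x \in reps lev, b \in reps lev & a \in reps lev].
Proof. by rewrite !mem_pairs -!andbA. Qed.

Lemma uniq_reps4 : uniq reps4.
Proof.
have h (X Y : eqType) (s : seq X) (t : seq Y) : uniq s -> uniq t ->
  uniq [seq (i, j) | i <- s, j <- t].
  by move=> us ut; rewrite allpairs_uniq // => -[i j] [i' j'] _ _.
by do 3![apply: (h); last exact: reps_uniq]; exact: reps_uniq.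
Qed.

Lemma reps4_ino p : p \in reps4 -> ino4 p.
Proof.
case: p => [[[z x] b] a]; rewrite mem_reps4 => /and4P[h1 h2 h3 h4].
by rewrite /= (reps_ino h1) (reps_ino h2) (reps_ino h3) (reps_ino h4).
Qed.

Lemma reps4_exists p : ino4 p -> exists2 r, r \in reps4 & lip4 p r.
Proof.
case: p => [[[z x] b] a] /and4P[/reps_lip[z' hz lz] /reps_lip[x' hx lx] /reps_lip[b' hb lb] /reps_lip[a' ha la]].
by exists (z', x', b', a'); [rewrite mem_reps4 hz hx hb | apply/and4P].
Qed.

Lemma reps4_eq p p' : p \in reps4 -> p' \in reps4 -> lip4 p p' -> p = p'.
Proof.
case: p p' => [[[z x] b] a] [[[z' x'] b'] a']; rewrite !mem_reps4.
move=> /and4P[h1 h2 h3 h4] /and4P[k1 k2 k3 k4] /and4P[l1 l2 l3 l4].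
by rewrite (reps_lip_eq h1 k1 l1) (reps_lip_eq h2 k2 l2) (reps_lip_eq h3 k3 l3) (reps_lip_eq h4 k4 l4).
Qed.

Definition dom4 (S : pred pt) : Prop :=
  (forall p, S p -> ino4 p) /\ (forall p p', S p -> lip4 p p' -> S p').

(** Being inverse to each other and preserving congruence, phi and psi induce inverse bijections of
    the classes modulo p^20. Periodicity of f' allows phi p to be replaced by its representative. *)
Lemma E4_bij (S S' : pred pt) (f f' : pt -> V) (phi psi : pt -> pt) :
  dom4 S -> dom4 S' ->
  (forall p, S p -> S' (phi p)) -> (forall p, S' p -> S (psi p)) ->
  (forall p, S p -> psi (phi p) = p) -> (forall p, S' p -> phi (psi p) = p) ->
  (forall p p', S p -> S p' -> lip4 p p' -> lip4 (phi p) (phi p')) ->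
  (forall p p', S' p -> S' p' -> lip4 p p' -> lip4 (psi p) (psi p')) ->
  (forall p p', S' p -> S' p' -> lip4 p p' -> f' p = f' p') ->
  (forall p, S p -> f p = f' (phi p)) ->
  E4 S f = E4 S' f'.
Proof.
move=> [dS pS] [dS' pS'] phiS psiS psiK phiK phil psil f'l ff'.
rewrite /E4 -!lock; congr (_ *: _); rewrite -big_filter -[RHS]big_filter.
apply: (@sum_match _ _ _ _ (fun p p' => lip4 (phi p) p')).
- exact/filter_uniq/uniq_reps4.
- exact/filter_uniq/uniq_reps4.
- move=> p; rewrite mem_filter => /andP[Sp _]; have Sq := phiS _ Sp.
  have [r hr h] := reps4_exists (dS' _ Sq); exists r => //.
  by rewrite mem_filter hr (pS' _ _ Sq h).
- move=> p'; rewrite mem_filter => /andP[Sp' _]; have Sq := psiS _ Sp'.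
  have [r hr h] := reps4_exists (dS _ Sq); have Sr := pS _ _ Sq h.
  exists r; first by rewrite mem_filter hr Sr.
  by apply: lip4_sym; rewrite -[p' in lip4 p' _]phiK //; apply: phil.
- move=> p p' p''; rewrite !mem_filter => _ /andP[_ h'] /andP[_ h''] l1 l2.
  exact: reps4_eq h' h'' (lip4_trans (lip4_sym l1) l2).
- move=> p p0 p'; rewrite !mem_filter => /andP[Sp h] /andP[Sp0 h0] _ l1 l2.
  apply: reps4_eq h h0 _; rewrite -(psiK _ Sp) -(psiK _ Sp0).
  by apply: psil; rewrite ?phiS //; apply: lip4_trans l1 (lip4_sym l2).
- move=> p p'; rewrite !mem_filter => /andP[Sp _] /andP[Sp' _] l.
  by rewrite ff' //; apply: f'l; rewrite ?phiS.
Qed.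

Lemma eq_E4 (S : pred pt) (f g : pt -> V) : (forall p, ino4 p -> S p -> f p = g p) -> E4 S f = E4 S g.
Proof.
move=> h; rewrite /E4 -!lock; congr (_ *: _); rewrite big_seq_cond [RHS]big_seq_cond.
by apply: eq_bigr => p /andP[/reps4_ino]; apply: h.
Qed.

Lemma E4_pred (S S' : pred pt) (f : pt -> V) : (forall p, ino4 p -> S p = S' p) -> E4 S f = E4 S' f.
Proof.
move=> h; rewrite /E4 -!lock; congr (_ *: _); rewrite big_seq_cond [RHS]big_seq_cond.
by apply: eq_bigl => p; case hp: (p \in reps4) => //=; apply/h/reps4_ino.
Qed.

Lemma E4_split (P S : pred pt) (f : pt -> V) :
  E4 S f = E4 (fun p => S p && P p) f + E4 (fun p => S p && ~~ P p) f.
Proof. by rewrite /E4 -!lock (bigID P) scalerDr. Qed.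

Lemma E4_linear (g : V -> V) (S : pred pt) (f : pt -> V) :
  (forall a x y, g (a *: x + y) = a *: g x + g y) -> g (E4 S f) = E4 S (g \o f).
Proof.
move=> gl; pose gh := GRing.isLinear.Build K V V *:%R g gl.
pose gL : {linear V -> V} := HB.pack g gh.
by rewrite -[g]/(gL : V -> V) /E4 -!lock linearZ linear_sum.
Qed.

Lemma E4_nest (S : pred pt) (f : pt -> V) :
  E4 S f = E1 ino (fun z => E1 ino (fun x => E1 ino (fun b => E1 ino (fun a =>
    if S (z, x, b, a) then f (z, x, b, a) else 0)))).
Proof.
have h (g : F -> V) : E1 ino g = Q ^- lev *: \sum_(x <- reps lev) g x.
  congr (_ *: _); rewrite big_seq_cond [RHS]big_seq.
  by apply: eq_bigl => x; case hx: (x \in _) => //=; rewrite (reps_ino hx).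
rewrite /E4 -lock big_mkcond /= !big_allpairs_dep /= h (exprM _ lev 4) !exprS expr0 mulr1 !invfM -!scalerA.
congr (_ *: _); rewrite !scaler_sumr; apply: eq_bigr => z _.
rewrite h; congr (_ *: _); rewrite !scaler_sumr; apply: eq_bigr => x _.
rewrite h; congr (_ *: _); rewrite !scaler_sumr; apply: eq_bigr => b _.
by rewrite h.
Qed.

Lemma E1_if0 (S : pred F) (P : bool) (g : F -> V) :
  E1 S (fun x => if P then g x else 0) = if P then E1 S g else 0.
Proof. by case: P => //; rewrite /E1 /mean big1 ?scaler0. Qed.

Lemma E4_prod (S1 S2 S3 S4 : pred F) (f : F -> F -> F -> F -> V) :
  E4 (fun '(z, x, b, a) => [&& S1 z, S2 x, S3 b & S4 a]) (fun '(z, x, b, a) => f z x b a) =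
  E1 S1 (fun z => E1 S2 (fun x => E1 S3 (fun b => E1 S4 (fun a => f z x b a)))).
Proof.
rewrite E4_nest [RHS]E1_mkcond; apply: eq_E1 => z _.
rewrite -E1_if0 [RHS]E1_mkcond; apply: eq_E1 => x _; rewrite -!E1_if0.
rewrite [RHS]E1_mkcond; apply: eq_E1 => b _; rewrite -!E1_if0.
rewrite [RHS]E1_mkcond; apply: eq_E1 => a _.
by case: (S1 z); case: (S2 x); case: (S3 b); case: (S4 a).
Qed.

Lemma integ4E (S1 S2 S3 S4 : pred F) (f : F -> F -> F -> F -> V) :
  dom S1 -> dom S2 -> dom S3 -> dom S4 ->
  (forall z z' x x' b b' a a', S1 z -> S1 z' -> S2 x -> S2 x' -> S3 b -> S3 b' -> S4 a -> S4 a' ->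
     lip 0 z z' -> lip 0 x x' -> lip 0 b b' -> lip 0 a a' -> f z x b a = f z' x' b' a') ->
  integ F vo w K V q R S1 (fun z => integ F vo w K V q R S2 (fun x =>
    integ F vo w K V q R S3 (fun b => integ F vo w K V q R S4 (fun a => f z x b a)))) =
  E4 (fun '(z, x, b, a) => [&& S1 z, S2 x, S3 b & S4 a]) (fun '(z, x, b, a) => f z x b a).
Proof.
move=> d1 d2 d3 d4 per; rewrite E4_prod.
(* [per] moves all variables at once; to vary a single one, [lip] must be reflexive at the others,
   which holds inside o. *)
have r (S : pred F) x : dom S -> S x -> lip 0 x x.
  by move=> [dS _] /dS h; apply: lip_refl.
have r1 x := r _ x d1; have r2 x := r _ x d2; have r3 x := r _ x d3; have r4 x := r _ x d4.
apply: integ_E1 => // [z hz|z z' hz hz' lz]; last first.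
  do 2![apply: eq_E1 => ? ?]; apply: eq_E1 => ? ?.
  by apply: per => //; auto.
have lz := r _ _ d1 hz.
apply: integ_E1 => // [x hx|x x' hx hx' lx]; last first.
  apply: eq_E1 => ? ?; apply: eq_E1 => ? ?.
  by apply: per => //; auto.
have lx := r _ _ d2 hx.
apply: integ_E1 => // [b hb|b b' hb hb' lb]; last first.
  apply: eq_E1 => ? ?.
  by apply: per => //; auto.
have lb := r _ _ d3 hb.
by apply: integ_E1 => // a a' ha ha' la; apply: per.
Qed.

(* A dummy variable d in p, of total mass 1/q, makes every integral fourfold. *)
Lemma integ3E (S1 S2 S3 : pred F) (f : F -> F -> F -> V) :
  dom S1 -> dom S2 -> dom S3 ->
  (forall z z' x x' b b', S1 z -> S1 z' -> S2 x -> S2 x' -> S3 b -> S3 b' ->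
     lip 0 z z' -> lip 0 x x' -> lip 0 b b' -> f z x b = f z' x' b') ->
  integ F vo w K V q R S1 (fun z => integ F vo w K V q R S2 (fun x =>
    integ F vo w K V q R S3 (fun b => f z x b))) =
  Q *: E4 (fun '(z, x, b, d) => [&& S1 z, S2 x, S3 b & inp 1 d]) (fun '(z, x, b, d) => f z x b).
Proof.
move=> d1 d2 d3 per; rewrite E4_prod.
have r (S : pred F) x : dom S -> S x -> lip 0 x x.
  by move=> [dS _] /dS h; apply: lip_refl.
have r1 x := r _ x d1; have r2 x := r _ x d2; have r3 x := r _ x d3.
rewrite -E1Z; apply: integ_E1 => // [z hz|z z' hz hz' lz]; last first.
  congr (_ *: _); do 2![apply: eq_E1 => ? ?]; apply: eq_E1 => ? ?.
  by apply: per => //; auto.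
have lz := r _ _ d1 hz.
rewrite -E1Z; apply: integ_E1 => // [x hx|x x' hx hx' lx]; last first.
  congr (_ *: _); apply: eq_E1 => ? ?; apply: eq_E1 => ? ?.
  by apply: per => //; auto.
have lx := r _ _ d2 hx.
rewrite -E1Z; apply: integ_E1 => // [b hb|b b' hb hb' lb].
  by rewrite E1p_const scalerA mulfV ?scale1r ?Q_neq0.
by congr (_ *: _); apply: eq_E1 => ? ?; apply: per.
Qed.

Lemma integ2E (S1 S2 : pred F) (f : F -> F -> V) :
  dom S1 -> dom S2 ->
  (forall z z' x x', S1 z -> S1 z' -> S2 x -> S2 x' -> lip 0 z z' -> lip 0 x x' -> f z x = f z' x') ->
  integ F vo w K V q R S1 (fun z => integ F vo w K V q R S2 (fun x => f z x)) =
  Q ^+ 2 *: E4 (fun '(z, x, d, d') => [&& S1 z, S2 x, inp 1 d & inp 1 d'])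
            (fun '(z, x, d, d') => f z x).
Proof.
move=> d1 d2 per; rewrite E4_prod.
have r (S : pred F) x : dom S -> S x -> lip 0 x x.
  by move=> [dS _] /dS h; apply: lip_refl.
have r1 x := r _ x d1; have r2 x := r _ x d2.
rewrite -E1Z; apply: integ_E1 => // [z hz|z z' hz hz' lz]; last first.
  congr (_ *: _); do 2![apply: eq_E1 => ? ?]; apply: eq_E1 => ? ?.
  by apply: per => //; auto.
have lz := r _ _ d1 hz.
rewrite -E1Z; apply: integ_E1 => // [x hx|x x' hx hx' lx]; last first.
  by congr (_ *: _); do 2![apply: eq_E1 => ? ?]; apply: per.
by rewrite !E1p_const !scalerA expr2 mulrACA mulfV ?mulr1 ?scale1r ?Q_neq0.
Qed.

Lemma E4_scale1 (S : pred pt) (f : pt -> V) :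
  dom4 S -> (forall '(z, x, b, a), S (z, x, b, a) -> inp 1 z) ->
  (forall p p', S p -> S p' -> lip4 p p' -> f p = f p') ->
  E4 S f = Q^-1 *: E4 (fun '(z, x, b, a) => [&& ino z, ino x, ino b, ino a & S (w * z, x, b, a)])
                     (fun '(z, x, b, a) => f (w * z, x, b, a)).
Proof.
move=> [dS pS] Sp fl; rewrite !E4_nest.
(* For z outside p the integrand vanishes, because S forces its first coordinate into p. *)
have -> : E1 ino (fun z => E1 ino (fun x => E1 ino (fun b => E1 ino (fun a =>
    if S (z, x, b, a) then f (z, x, b, a) else 0)))) =
  E1 (inp 1) (fun z => E1 ino (fun x => E1 ino (fun b => E1 ino (fun a =>
    if S (z, x, b, a) then f (z, x, b, a) else 0)))).
  rewrite [RHS]E1_mkcond; apply: eq_E1 => z _; case: ifP => // nz.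
  rewrite -[RHS]E1_const; apply: eq_E1 => x _; rewrite -[RHS]E1_const; apply: eq_E1 => b _.
  rewrite -[RHS]E1_const; apply: eq_E1 => a _; case: ifP => // /(Sp (z, x, b, a)).
  by rewrite nz.
rewrite E1_scale; last first.
  move=> z z' hz hz' lz; apply: eq_E1 => x hx; apply: eq_E1 => b hb; apply: eq_E1 => a ha.
  have l : lip4 (z, x, b, a) (z', x, b, a) by rewrite /= lz !lip_refl.
  have -> : S (z, x, b, a) = S (z', x, b, a).
    by apply/idP/idP => h; apply: pS h _ => //; apply: lip4_sym.
  by case: ifP => // h; apply: fl => //; apply: pS h (lip4_sym l).
congr (_ *: _); apply: eq_E1 => z hz; apply: eq_E1 => x hx; apply: eq_E1 => b hb.
by apply: eq_E1 => a ha; rewrite hz hx hb ha.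
Qed.

(** * Matrices and cosets *)

Local Notation mk4 := (mk4 F).
Local Notation Jp := (Jp F).
Local Notation gsp4 := (gsp4 F).

Lemma mk4_eq a11 a12 a13 a14 a21 a22 a23 a24 a31 a32 a33 a34 a41 a42 a43 a44
             b11 b12 b13 b14 b21 b22 b23 b24 b31 b32 b33 b34 b41 b42 b43 b44 :
  a11 = b11 -> a12 = b12 -> a13 = b13 -> a14 = b14 ->
  a21 = b21 -> a22 = b22 -> a23 = b23 -> a24 = b24 ->
  a31 = b31 -> a32 = b32 -> a33 = b33 -> a34 = b34 ->
  a41 = b41 -> a42 = b42 -> a43 = b43 -> a44 = b44 ->
  mk4 [:: [:: a11; a12; a13; a14]; [:: a21; a22; a23; a24];
          [:: a31; a32; a33; a34]; [:: a41; a42; a43; a44]] =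
  mk4 [:: [:: b11; b12; b13; b14]; [:: b21; b22; b23; b24];
          [:: b31; b32; b33; b34]; [:: b41; b42; b43; b44]].
Proof. by do 16![move=> ->]. Qed.

Lemma mk4M a11 a12 a13 a14 a21 a22 a23 a24 a31 a32 a33 a34 a41 a42 a43 a44
           b11 b12 b13 b14 b21 b22 b23 b24 b31 b32 b33 b34 b41 b42 b43 b44 :
  mk4 [:: [:: a11; a12; a13; a14]; [:: a21; a22; a23; a24];
          [:: a31; a32; a33; a34]; [:: a41; a42; a43; a44]] *m
  mk4 [:: [:: b11; b12; b13; b14]; [:: b21; b22; b23; b24];
          [:: b31; b32; b33; b34]; [:: b41; b42; b43; b44]] =
  mk4 [:: [:: a11 * b11 + a12 * b21 + a13 * b31 + a14 * b41;
              a11 * b12 + a12 * b22 + a13 * b32 + a14 * b42;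
              a11 * b13 + a12 * b23 + a13 * b33 + a14 * b43;
              a11 * b14 + a12 * b24 + a13 * b34 + a14 * b44];
          [:: a21 * b11 + a22 * b21 + a23 * b31 + a24 * b41;
              a21 * b12 + a22 * b22 + a23 * b32 + a24 * b42;
              a21 * b13 + a22 * b23 + a23 * b33 + a24 * b43;
              a21 * b14 + a22 * b24 + a23 * b34 + a24 * b44];
          [:: a31 * b11 + a32 * b21 + a33 * b31 + a34 * b41;
              a31 * b12 + a32 * b22 + a33 * b32 + a34 * b42;
              a31 * b13 + a32 * b23 + a33 * b33 + a34 * b43;
              a31 * b14 + a32 * b24 + a33 * b34 + a34 * b44];
          [:: a41 * b11 + a42 * b21 + a43 * b31 + a44 * b41;
              a41 * b12 + a42 * b22 + a43 * b32 + a44 * b42;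
              a41 * b13 + a42 * b23 + a43 * b33 + a44 * b43;
              a41 * b14 + a42 * b24 + a43 * b34 + a44 * b44]].
Proof.
apply/matrixP => -[[|[|[|[|//]]]] hi] -[[|[|[|[|//]]]] hj];
by rewrite !mxE !big_ord_recl big_ord0 !mxE /= addr0 -!addrA.
Qed.

Lemma mk4T a11 a12 a13 a14 a21 a22 a23 a24 a31 a32 a33 a34 a41 a42 a43 a44 :
  (mk4 [:: [:: a11; a12; a13; a14]; [:: a21; a22; a23; a24];
          [:: a31; a32; a33; a34]; [:: a41; a42; a43; a44]])^T =
  mk4 [:: [:: a11; a21; a31; a41]; [:: a12; a22; a32; a42];
          [:: a13; a23; a33; a43]; [:: a14; a24; a34; a44]].
Proof. by apply/matrixP => -[[|[|[|[|//]]]] hi] -[[|[|[|[|//]]]] hj]; rewrite !mxE. Qed.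

(** Every matrix of the formula has multiplier one, so all computations stay inside Sp(4). *)
Definition symp (g : 'M[F]_4) : Prop := g^T *m Jp *m g = Jp.

Lemma symp_gsp4 g : symp g -> gsp4 g.
Proof. by move=> h; exists 1; rewrite oner_neq0 scale1r. Qed.

Lemma sympM g h : symp g -> symp h -> symp (g *m h).
Proof.
rewrite /symp => hg hh.
have -> : (g *m h)^T *m Jp *m (g *m h) = h^T *m (g^T *m Jp *m g) *m h.
  by rewrite trmx_mul !mulmxA.
by rewrite hg.
Qed.

(** The unipotent radical of the Klingen parabolic, followed by the opposite radical, the SL(2) of
    the Levi factor and the diagonal torus of Sp(4). *)
Definition Heis l m k : 'M[F]_4 :=
  mk4 [:: [:: 1; l; m; k]; [:: 0; 1; 0; m]; [:: 0; 0; 1; - l]; [:: 0; 0; 0; 1]].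
Definition lHeis l m k : 'M[F]_4 :=
  mk4 [:: [:: 1; 0; 0; 0]; [:: l; 1; 0; 0]; [:: m; 0; 1; 0]; [:: k; m; - l; 1]].
Definition Mid A B C D : 'M[F]_4 :=
  mk4 [:: [:: 1; 0; 0; 0]; [:: 0; A; B; 0]; [:: 0; C; D; 0]; [:: 0; 0; 0; 1]].
Definition Tor d1 d2 : 'M[F]_4 :=
  mk4 [:: [:: d1; 0; 0; 0]; [:: 0; d2; 0; 0]; [:: 0; 0; d2^-1; 0]; [:: 0; 0; 0; d1^-1]].

Ltac mk4_tac := rewrite /symp /Defs.Jp /Heis /lHeis /Mid /Tor ?mk4T ?mk4M; apply: mk4_eq.

Lemma symp_Heis l m k : symp (Heis l m k). Proof. by mk4_tac; ring. Qed.
Lemma symp_lHeis l m k : symp (lHeis l m k). Proof. by mk4_tac; ring. Qed.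
Lemma symp_Mid A B C D : A * D - B * C = 1 -> symp (Mid A B C D).
Proof.
move=> h; have e : A * D = 1 + B * C by rewrite -h subrK.
by mk4_tac; ring: e.
Qed.
Lemma symp_Tor d1 d2 : d1 != 0 -> d2 != 0 -> symp (Tor d1 d2).
Proof. by move=> h1 h2; mk4_tac; try ring; field; rewrite ?h1 ?h2. Qed.
Lemma symp_t4 : symp (t4 F w).
Proof. by rewrite /t4; mk4_tac; try ring; field; rewrite w_neq0. Qed.

Lemma inK0 (k : 'M[F]_4) : symp k -> (forall i j, ino (k i j)) -> inKpara F vo 0 k.
Proof.
move=> sk hk; exists 1; split; [exact: unit1|split; first by rewrite scale1r].
by move=> i j; rewrite /expo; do ?case: ifP => _; exact: hk.
Qed.

Variables (chi : F -> K) (pi : 'M[F]_4 -> V -> V).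
Hypothesis hchi : quad_char_cond_p F vo K chi.
Hypothesis hpi : smooth_rep F vo K V pi.
Variables (v : V) (hv : inV0 F vo K V pi v).

Lemma pi_coset g h k u : symp g -> symp h -> g *m h = k -> pi k u = pi g (pi h u).
Proof. by move=> sg sh <-; rewrite (rep_mul _ _ _ _ _ hpi) //; apply: symp_gsp4. Qed.

Lemma pi_fix (k : 'M[F]_4) : symp k -> (forall i j, ino (k i j)) -> pi k v = v.
Proof. by move=> sk hk; apply/hv/inK0. Qed.

Lemma pi_Heis l m k : ino l -> ino m -> ino k -> pi (Heis l m k) v = v.
Proof.
move=> hl hm hk; apply: pi_fix; first exact: symp_Heis.
by case=> [[|[|[|[|//]]]] hi] [[|[|[|[|//]]]] hj]; rewrite !mxE //=; rewrite ?inoN ?ino1 ?ino0.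
Qed.

Lemma pi_lHeis l m k : ino l -> ino m -> ino k -> pi (lHeis l m k) v = v.
Proof.
move=> hl hm hk; apply: pi_fix; first exact: symp_lHeis.
by case=> [[|[|[|[|//]]]] hi] [[|[|[|[|//]]]] hj]; rewrite !mxE //=; rewrite ?inoN ?ino1 ?ino0.
Qed.

Lemma pi_Mid A B C D : A * D - B * C = 1 -> ino A -> ino B -> ino C -> ino D ->
  pi (Mid A B C D) v = v.
Proof.
move=> e hA hB hC hD; apply: pi_fix; first exact: symp_Mid.
by case=> [[|[|[|[|//]]]] hi] [[|[|[|[|//]]]] hj]; rewrite !mxE //=; rewrite ?ino1 ?ino0.
Qed.

Lemma pi_Tor u1 u2 : isunit u1 -> isunit u2 -> pi (Tor u1 u2) v = v.
Proof.
move=> h1 h2; apply: pi_fix; first by apply: symp_Tor; exact: unit_neq0.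
have [k1 k2] := (unit_ino (unitV h1), unit_ino (unitV h2)).
by case=> [[|[|[|[|//]]]] hi] [[|[|[|[|//]]]] hj]; rewrite !mxE //=; rewrite ?(unit_ino h1) ?(unit_ino h2) ?k1 ?k2 ?ino0.
Qed.

Definition Bm d1 d2 l m k t : 'M[F]_4 :=
  mk4 [:: [:: d1; d1 * l; d1 * (m + l * t); d1 * k]; [:: 0; d2; d2 * t; d2 * m];
          [:: 0; 0; d2^-1; - (d2^-1 * l)]; [:: 0; 0; 0; d1^-1]].

Lemma BmE d1 d2 l m k t : Bm d1 d2 l m k t = Tor d1 d2 *m Heis l m k *m Mid 1 t 0 1.
Proof. by rewrite /Bm; mk4_tac; ring. Qed.

Lemma symp_Bm d1 d2 l m k t : d1 != 0 -> d2 != 0 -> symp (Bm d1 d2 l m k t).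
Proof.
move=> h1 h2; rewrite BmE; apply: sympM; last by apply: symp_Mid; ring.
by apply: sympM; [exact: symp_Tor | exact: symp_Heis].
Qed.

Definition Phi d1 d2 l m k t : V := pi (Bm d1 d2 l m k t) v.

(** An integral Heisenberg element on the right fixes v. Moving it past the t factor turns ga into
    ga - t*be; the last coordinate acquires the Heisenberg cocycle. *)
Lemma Phi_H d1 d2 l m k t be ga ep : d1 != 0 -> d2 != 0 -> ino be -> ino ga -> ino ep ->
  Phi d1 d2 l m k t =
  Phi d1 d2 (l + be) (m + ga - t * be) (k + ep + l * (ga - t * be) - m * be) t.
Proof.
move=> h1 h2 hb hg he; rewrite /Phi [RHS](@pi_coset (Bm d1 d2 l m k t) (Heis be ga ep)).
- by rewrite pi_Heis.
- exact: symp_Bm.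
- exact: symp_Heis.
- by rewrite /Bm; mk4_tac; ring.
Qed.

Lemma Phi_t d1 d2 l m k t t' : d1 != 0 -> d2 != 0 -> ino (t' - t) ->
  Phi d1 d2 l m k t = Phi d1 d2 l m k t'.
Proof.
move=> h1 h2 ht; rewrite /Phi [RHS](@pi_coset (Bm d1 d2 l m k t) (Mid 1 (t' - t) 0 1)).
- by rewrite pi_Mid ?ino1 ?ino0 //; ring.
- exact: symp_Bm.
- by apply: symp_Mid; ring.
- by rewrite /Bm; mk4_tac; ring.
Qed.

(** A torus element with unit entries fixes v; moving it to the right end conjugates the
    coordinates. *)
Lemma Phi_unit d1 d2 u1 u2 l m k t : d1 != 0 -> d2 != 0 -> isunit u1 -> isunit u2 ->
  Phi (d1 * u1) (d2 * u2) l m k t =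
  Phi d1 d2 (u1 * l / u2) (u1 * u2 * m) (u1 ^+ 2 * k) (u2 ^+ 2 * t).
Proof.
move=> h1 h2 hu1 hu2; have [n1 n2] := (unit_neq0 hu1, unit_neq0 hu2).
rewrite /Phi [LHS](@pi_coset (Bm d1 d2 (u1 * l / u2) (u1 * u2 * m) (u1 ^+ 2 * k) (u2 ^+ 2 * t)) (Tor u1 u2)).
- by rewrite pi_Tor.
- exact: symp_Bm.
- exact: symp_Tor.
- by rewrite /Bm; mk4_tac; try ring; field; rewrite ?n1 ?n2 ?h1 ?h2.
Qed.

(* In t4 H(l,m,k) the lower right corner dominates: one applies the Iwasawa
   decomposition of SL(2) to its entries indexed by 1, 4, then to the middle
   block, according to which entry of its second row dominates. *)
Lemma Phi_t4_D d2 l m k t (D := 1 + l * (m + l * t) / k) :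
  d2 != 0 -> k != 0 -> D != 0 ->
  ino k^-1 -> ino (l / k) -> ino ((m + l * t) / k) -> ino (l ^+ 2 / k / D) ->
  pi (t4 F w) (Phi 1 d2 l m k t) =
  Phi (w ^- 4 / k) (d2 / D) (l / D) (m * D) (- k) ((- m ^+ 2 / k + t * (1 - l * m / k)) * D).
Proof.
move=> h2 hk hD i1 i2 i3 i4; rewrite /Phi.
have w0 := w_neq0.
have s1 : symp (Bm 1 d2 l m k t) by apply: symp_Bm; rewrite ?oner_neq0 //.
have s2 : symp (Bm (w ^- 4 / k) (d2 / D) (l / D) (m * D) (- k) ((- m ^+ 2 / k + t * (1 - l * m / k)) * D)).
  by apply: symp_Bm; rewrite ?mulf_neq0 ?invr_eq0 ?expf_neq0.
have s3 : symp (Mid 1 0 (l ^+ 2 / k / D) 1) by apply: symp_Mid; ring.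
rewrite -(pi_coset v symp_t4 s1 (erefl _)).
(* The integral factors of the decomposition are inserted next to v, which they fix; what remains is
   an equality of two matrices. *)
rewrite -[in RHS](@pi_Mid 1 0 (l ^+ 2 / k / D) 1) ?ino1 ?ino0 //; last by ring.
rewrite -[in RHS](@pi_lHeis (- ((m + l * t) / k)) (l / k) k^-1) ?inoN //.
rewrite -(pi_coset _ s3 (symp_lHeis _ _ _) (erefl _)).
rewrite -(pi_coset _ s2 (sympM s3 (symp_lHeis _ _ _)) (erefl _)).
congr (pi _ v); move: hD; rewrite /D => hD.
have hD' : k + l * (m + l * t) != 0.
  by apply: contraNneq hD => e; rewrite -[1](divff hk) -mulrDl e mul0r.
rewrite /t4 /Bm; mk4_tac; try ring; field; rewrite ?w0 ?h2 ?hk ?hD' ?hD ?oner_neq0 //.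
Qed.

Lemma Phi_t4_C d2 l m k t (A := 1 - l * m / k) (C := l ^+ 2 / k) (D := 1 + l * (m + l * t) / k) :
  d2 != 0 -> k != 0 -> l != 0 ->
  ino k^-1 -> ino (l / k) -> ino ((m + l * t) / k) -> ino (D / C) ->
  pi (t4 F w) (Phi 1 d2 l m k t) =
  Phi (w ^- 4 / k) (d2 / C) (l / C) (m * C) (- k) (A * C).
Proof.
move=> h2 hk hl i1 i2 i3 i4; rewrite /Phi.
have w0 := w_neq0.
have hC : C != 0 by rewrite mulf_neq0 ?expf_neq0 ?invr_eq0.
have s1 : symp (Bm 1 d2 l m k t) by apply: symp_Bm; rewrite ?oner_neq0 //.
have s2 : symp (Bm (w ^- 4 / k) (d2 / C) (l / C) (m * C) (- k) (A * C)).
  by apply: symp_Bm; rewrite ?mulf_neq0 ?invr_eq0 ?expf_neq0.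
have s3 : symp (Mid 0 (-1) 1 (D / C)) by apply: symp_Mid; ring.
rewrite -(pi_coset v symp_t4 s1 (erefl _)).
rewrite -[in RHS](@pi_Mid 0 (-1) 1 (D / C)) ?inoN ?ino1 ?ino0 //; last by ring.
rewrite -[in RHS](@pi_lHeis (- ((m + l * t) / k)) (l / k) k^-1) ?inoN //.
rewrite -(pi_coset _ s3 (symp_lHeis _ _ _) (erefl _)).
rewrite -(pi_coset _ s2 (sympM s3 (symp_lHeis _ _ _)) (erefl _)).
congr (pi _ v); rewrite /A /C /D /t4 /Bm; mk4_tac; try ring; field; rewrite ?w0 ?h2 ?hk ?hl ?oner_neq0 //.
Qed.

(** The form used in applications: the torus entries are prescribed up to units, which pass into the
    coordinates, and D is an argument so that a simplified expression can be given for it. *)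
Lemma Phi_t4_D_unit D d1' d2' u1 u2 d2 l m k t :
  1 + l * (m + l * t) / k = D -> w ^- 4 / k = d1' * u1 -> d2 / D = d2' * u2 -> isunit u1 -> isunit u2 ->
  d2 != 0 -> k != 0 -> D != 0 ->
  ino k^-1 -> ino (l / k) -> ino ((m + l * t) / k) -> ino (l ^+ 2 / k / D) ->
  pi (t4 F w) (Phi 1 d2 l m k t) =
  Phi d1' d2' (u1 * (l / D) / u2) (u1 * u2 * (m * D)) (u1 ^+ 2 * - k)
    (u2 ^+ 2 * ((- m ^+ 2 / k + t * (1 - l * m / k)) * D)).
Proof.
move=> <- e1 e2 hu1 hu2 h2 hk hD i1 i2 i3 i4; rewrite Phi_t4_D // e1 e2 Phi_unit //.
  have : w ^- 4 / k != 0 by rewrite mulf_neq0 ?invr_eq0 ?expf_neq0 ?w_neq0.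
  by rewrite e1 mulf_eq0 negb_or => /andP[].
have := mulf_neq0 h2 (invr_neq0 hD).
by rewrite e2 mulf_eq0 negb_or => /andP[].
Qed.

Lemma Phi_t4_C_unit C D d1' d2' u1 u2 d2 l m k t (A := 1 - l * m / k) :
  l ^+ 2 / k = C -> 1 + l * (m + l * t) / k = D -> w ^- 4 / k = d1' * u1 -> d2 / C = d2' * u2 -> isunit u1 -> isunit u2 ->
  d2 != 0 -> k != 0 -> l != 0 ->
  ino k^-1 -> ino (l / k) -> ino ((m + l * t) / k) -> ino (D / C) ->
  pi (t4 F w) (Phi 1 d2 l m k t) =
  Phi d1' d2' (u1 * (l / C) / u2) (u1 * u2 * (m * C)) (u1 ^+ 2 * - k) (u2 ^+ 2 * (A * C)).
Proof.
move=> <- <- e1 e2 hu1 hu2 h2 hk hl i1 i2 i3 i4; rewrite Phi_t4_C // e1 e2 Phi_unit //.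
  have : w ^- 4 / k != 0 by rewrite mulf_neq0 ?invr_eq0 ?expf_neq0 ?w_neq0.
  by rewrite e1 mulf_eq0 negb_or => /andP[].
have : d2 / (l ^+ 2 / k) != 0 by rewrite mulf_neq0 ?invr_eq0 // mulf_neq0 ?expf_neq0 ?invr_eq0.
by rewrite e2 mulf_eq0 negb_or => /andP[].
Qed.

(** The upper right entry is forced by determinant one. When C dominates D, the block split off on
    the right, after conjugating the Heisenberg element, lies in SL(2,o). *)
Lemma pi_Mid_Heis_C A C D l m k : C != 0 -> ino (D / C) ->
  pi (Mid A ((A * D - 1) / C) C D *m Heis l m k) v =
  Phi 1 C^-1 (l * D / C - m) (l - A * C * (l * D / C - m)) k (A * C).
Proof.
move=> hC hD; rewrite /Phi [LHS](@pi_coset (Bm 1 C^-1 (l * D / C - m) (l - A * C * (l * D / C - m)) k (A * C)) (Mid 0 (-1) 1 (D / C))).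
- by rewrite pi_Mid ?inoN ?ino1 ?ino0 //; ring.
- by apply: symp_Bm; rewrite ?oner_neq0 ?invr_eq0.
- by apply: symp_Mid; ring.
- by rewrite /Bm; mk4_tac; try ring; field; rewrite ?hC ?oner_neq0 //.
Qed.

Lemma pi_Mid_Heis_D B C D l m k : D != 0 -> ino (C / D) ->
  pi (Mid ((1 + B * C) / D) B C D *m Heis l m k) v =
  Phi 1 D^-1 (l - m * C / D) (m - B * D * (l - m * C / D)) k (B * D).
Proof.
move=> hD hC; rewrite /Phi [LHS](@pi_coset (Bm 1 D^-1 (l - m * C / D) (m - B * D * (l - m * C / D)) k (B * D)) (Mid 1 0 (C / D) 1)).
- by rewrite pi_Mid ?inoN ?ino1 ?ino0 //; ring.
- by apply: symp_Bm; rewrite ?oner_neq0 ?invr_eq0.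
- by apply: symp_Mid; ring.
- by rewrite /Bm; mk4_tac; try ring; field; rewrite ?hD ?oner_neq0 //.
Qed.

Lemma tauE : tau F w = Tor 1 w^-1. Proof. by rewrite /tau /Tor invr1 invrK. Qed.
Lemma tauiE : taui F w = Tor 1 w. Proof. by rewrite /taui /Tor invr1. Qed.
Lemma etaE : Defs.eta F w = Tor w^-1 1. Proof. by rewrite /Defs.eta /Tor invr1 invrK. Qed.

Lemma pi_Tor_Phi d1 d2 e1 e2 l m k t : d1 != 0 -> d2 != 0 -> e1 != 0 -> e2 != 0 ->
  pi (Tor d1 d2) (Phi e1 e2 l m k t) = Phi (d1 * e1) (d2 * e2) l m k t.
Proof.
move=> h1 h2 k1 k2; rewrite -(pi_coset v _ _ (erefl _)); [|exact: symp_Tor|exact: symp_Bm].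
by congr (pi _ v); rewrite /Bm; mk4_tac; try ring; field; rewrite ?h1 ?h2 ?k1 ?k2.
Qed.

Lemma pi_XY al r s t : pi (Xm F al *m Ym F r s t) v = Phi 1 1 al r (s + al * r) t.
Proof. by congr (pi _ v); rewrite /Bm /Xm /Ym invr1; mk4_tac; ring. Qed.

Lemma pi_Y r s t : pi (Ym F r s t) v = Phi 1 1 0 r s t.
Proof. by congr (pi _ v); rewrite /Bm /Ym invr1; mk4_tac; ring. Qed.

Lemma symp_Lm_nm x a b c : symp (Lm F x *m nm F w a b c).
Proof. by apply: sympM; rewrite /Lm /nm; mk4_tac; ring. Qed.

Lemma symp_s1 : symp (s1 F). Proof. by rewrite /s1; mk4_tac; ring. Qed.

Lemma symp_tau : symp (tau F w).
Proof. by rewrite tauE; apply: symp_Tor; rewrite ?oner_neq0 ?invr_eq0 ?w_neq0. Qed.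

(** L(x) n tau = (L(x) tau)(tau^-1 n tau): a middle block times a Heisenberg element. *)
Lemma pi_Ln_tau x a b c :
  pi (Lm F x *m nm F w a b c) (pi (tau F w) v) =
  pi (Mid w^-1 0 (x / w) w *m Heis (- a * w ^- 2) (b / w) c) v.
Proof.
rewrite -(pi_coset v (symp_Lm_nm _ _ _ _) symp_tau (erefl _)); congr (pi _ v).
by rewrite /Lm /nm /tau; mk4_tac; try ring; field; rewrite w_neq0.
Qed.

Lemma pi_sLn_tau y a b c :
  pi (s1 F *m Lm F y *m nm F w a b c) (pi (tau F w) v) =
  pi (Mid (y / w) w (- w^-1) 0 *m Heis (- a * w ^- 2) (b / w) c) v.
Proof.
have s := sympM symp_s1 (symp_Lm_nm y a b c); rewrite mulmxA in s.
rewrite -(pi_coset v s symp_tau (erefl _)); congr (pi _ v).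
by rewrite /s1 /Lm /nm /tau; mk4_tac; try ring; field; rewrite w_neq0.
Qed.

Lemma pi_t4_Ln x a b c u :
  pi (t4 F w *m Lm F x *m nm F w a b c) u = pi (t4 F w) (pi (Lm F x *m nm F w a b c) u).
Proof. by apply: pi_coset; [exact: symp_t4 | exact: symp_Lm_nm | rewrite mulmxA]. Qed.

Lemma pi_t4_sLn y a b c u :
  pi (t4 F w *m s1 F *m Lm F y *m nm F w a b c) u =
  pi (t4 F w) (pi (s1 F *m Lm F y *m nm F w a b c) u).
Proof.
apply: pi_coset; [exact: symp_t4 | | by rewrite !mulmxA].
by have := sympM symp_s1 (symp_Lm_nm y a b c); rewrite mulmxA.
Qed.

(** * The operator L(x) n(a,b,c) tau *)

Lemma E1_exchange (S S' : pred F) (f : F -> F -> V) :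
  E1 S (fun x => E1 S' (fun y => f x y)) = E1 S' (fun y => E1 S (fun x => f x y)).
Proof.
rewrite /E1 /mean -!scaler_sumr !scalerA; congr (_ *: _).
exact: exchange_big.
Qed.

Lemma E4_swap (S : pred pt) (f : pt -> V) :
  E4 S f = E4 (fun '(x, z, b, a) => S (z, x, b, a)) (fun '(x, z, b, a) => f (z, x, b, a)).
Proof. by rewrite !E4_nest E1_exchange. Qed.

Lemma Phi_norm d1' d2' u1 u2 d1 d2 l m k t : d1 = d1' * u1 -> d2 = d2' * u2 ->
  d1' != 0 -> d2' != 0 -> isunit u1 -> isunit u2 ->
  Phi d1 d2 l m k t = Phi d1' d2' (u1 * l / u2) (u1 * u2 * m) (u1 ^+ 2 * k) (u2 ^+ 2 * t).
Proof. by move=> -> ->; exact: Phi_unit. Qed.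

(** With at most six digits lost, all differences lie in p^14 and their products with coordinates in
    p^8, so the two cosets differ by an integral translation. *)
Lemma Phi_lip d1 d2 i1 i2 i3 i4 l m k t l' m' k' t' :
  d1 != 0 -> d2 != 0 ->
  lip i1 l l' -> lip i2 m m' -> lip i3 k k' -> lip i4 t t' ->
  (i1 <= 6)%N -> (i2 <= 6)%N -> (i3 <= 6)%N -> (i4 <= 6)%N ->
  Phi d1 d2 l m k t = Phi d1 d2 l' m' k' t'.
Proof.
move=> h1 h2 hl hm hk ht n1 n2 n3 n4.
case/and3P: (lip_le n1 hl) => l1 l2 l3; case/and3P: (lip_le n2 hm) => m1 m2 m3.
case/and3P: (lip_le n3 hk) => k1 k2 k3; case/and3P: (lip_le n4 ht) => t1 t2 t3.
have sub (n : int) x : inp n x -> 0 <= n -> ino x by move=> h n0; apply: inp_sub h.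
have N1 x y (n : int) : inp n (x - y) -> inp n (y - x) by move=> h; rewrite -(opprB x y) inpN.
rewrite (@Phi_t _ _ _ _ _ t t') //; last by apply: sub (N1 _ _ _ t3) _.
rewrite (@Phi_H _ _ _ _ _ _ (l' - l) (m' - m + t' * (l' - l))
           (k' - k - l * (m' - m) + m * (l' - l))) //.
- congr Phi; ring.
- by apply: sub (N1 _ _ _ l3) _.
- apply: inoD; first by apply: sub (N1 _ _ _ m3) _.
  by apply: sub (inpM t2 (N1 _ _ _ l3)) _.
- apply: inoD; last by apply: sub (inpM m1 (N1 _ _ _ l3)) _.
  apply: inoD; first by apply: sub (N1 _ _ _ k3) _.
  by apply/inoN; apply: sub (inpM l1 (N1 _ _ _ m3)) _.
Qed.

(** A quadratic chi of conductor p identifies units that agree modulo p up to the square of a unit.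
    The root s is supplied in each application. *)
Lemma chi_eq s e e' : isunit e -> isunit s -> inp 1 (e' - e * s ^+ 2) -> chi e = chi e'.
Proof.
move=> he hs h; have [e0 s0] := (unit_neq0 he, unit_neq0 hs).
have es : isunit (e * s ^+ 2) by rewrite unitM ?unitX.
have -> : e' = e * s ^+ 2 * (1 + (e' - e * s ^+ 2) / (e * s ^+ 2)) by field; rewrite e0 s0.
have h' : inp 1 ((e' - e * s ^+ 2) / (e * s ^+ 2)) by apply: inp1Ml h (unit_ino (unitV es)).
have n1 : 1 + (e' - e * s ^+ 2) / (e * s ^+ 2) != 0 by apply/unit_neq0/unitDp => //; exact: unit1.
rewrite (ch_mul _ _ _ _ hchi) ?(unit_neq0 es) // (ch_1p _ _ _ _ hchi) // mulr1.
rewrite (ch_mul _ _ _ _ hchi) ?expf_neq0 // expr2 (ch_mul _ _ _ _ hchi) // -expr2.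
by rewrite (ch_sq _ _ _ _ hchi) // mulr1.
Qed.

Lemma chi_lip e e' : isunit e -> lip 0 e e' -> chi e = chi e'.
Proof.
move=> he h; apply: (@chi_eq 1) => //; first exact: unit1.
rewrite expr1n mulr1 -opprB inpN //; case/and3P: h => _ _; exact: inp_sub.
Qed.

Lemma U1P z : unit_not1 F vo z -> isunit z * isunit (1 - z).
Proof.
case/andP => hz nz; split=> //; apply: ino_unit; first by rewrite inoD ?ino1 ?inoN ?unit_ino.
by apply: contra nz => /inpN; rewrite opprB.
Qed.

Lemma U1I z : isunit z -> isunit (1 - z) -> unit_not1 F vo z.
Proof.
by move=> hz h; rewrite /unit_not1 hz; apply: contra (unit_notp h) => /inpN; rewrite opprB.
Qed.

Lemma dom4_prod (S1 S2 S3 S4 : pred F) : dom S1 -> dom S2 -> dom S3 -> dom S4 ->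
  dom4 (fun '(z, x, b, a) => [&& S1 z, S2 x, S3 b & S4 a]).
Proof.
move=> [d1 p1] [d2 p2] [d3 p3] [d4 p4]; split=> [[[[z x] b] a]|[[[z x] b] a] [[[z' x'] b'] a']].
  by case/and4P => *; apply/and4P; split; auto.
by case/and4P => ? ? ? ? /and4P[? ? ? ?]; apply/and4P; split; eauto.
Qed.

(** A sum is recognised as a unit only if it is a hypothesis or if one summand is visibly a unit and
    the other visibly in p; otherwise a rewritten form must be supplied. *)
Ltac mem :=
  match goal with
  | H : is_true ?P |- is_true ?P => exact H
  | |- is_true (Defs.isunit _ _ 1) => exact: unit1
  | |- is_true (Defs.isunit _ _ (?x * ?y)) => apply: unitM; mem
  | |- is_true (Defs.isunit _ _ (- ?x)) => apply: unitN; mem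
  | |- is_true (Defs.isunit _ _ (?x^-1)) => apply: unitV; mem
  | |- is_true (Defs.isunit _ _ (?x ^+ ?n)) => apply: unitX; mem
  | |- is_true (Defs.isunit _ _ (?x + ?y)) =>
      first [apply: unitDp; solve [mem] | apply: unitpD; solve [mem]]
  | |- is_true (Defs.inp _ _ 1 0) => exact: inp0
  | |- is_true (Defs.inp _ _ 1 (Defs.isunit _ _ _)) => fail
  | |- is_true (Defs.inp _ _ 1 (?x + ?y)) => apply: inpD; mem
  | |- is_true (Defs.inp _ _ 1 (- ?x)) => apply: inpN; mem
  | |- is_true (Defs.inp _ _ 1 (?x * ?y)) =>
      first [apply: inp1Ml; solve [mem] | apply: inp1Mr; solve [mem]]
  | |- is_true (Defs.inp _ _ 1 (?x ^+ _.+1)) => apply: inp1X; mem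
  | |- is_true (Defs.inp _ _ 1 _) => exact: inp1w1
  | |- is_true (Defs.ino _ _ 0) => exact: ino0
  | |- is_true (Defs.ino _ _ 1) => exact: ino1
  | |- is_true (Defs.ino _ _ _%:R) => exact: inoNat
  | |- is_true (Defs.ino _ _ (?x + ?y)) => apply: inoD; mem
  | |- is_true (Defs.ino _ _ (- ?x)) => apply: inoN; mem
  | |- is_true (Defs.ino _ _ (?x * ?y)) => apply: inoM; mem
  | |- is_true (Defs.ino _ _ (?x ^+ ?n)) => apply: inoX; mem
  | |- is_true (Defs.ino _ _ (?x^-1)) => apply: unit_ino; apply: unitV; mem
  | |- is_true (Defs.ino _ _ ?x) =>
      first [exact: inow | match goal with H : is_true (Defs.isunit _ _ x) |- _ => exact: unit_ino H end
            | match goal with H : is_true (Defs.inp _ _ 1 x) |- _ => exact: inp1_ino H end]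
  end.

Ltac lipr :=
  match goal with
  | H : is_true (lip _ ?x ?y) |- is_true (lip _ ?x ?y) => exact H
  | |- is_true (lip _ 0 0) => exact: lip_0
  | |- is_true (lip _ 1 1) => exact: lip_1
  | |- is_true (lip _ w w) => exact: lip_w
  | |- is_true (lip _ (w^-1) (w^-1)) => exact: lip_wV
  | |- is_true (lip _ (w ^- _) (w ^- _)) => exact: lip_wXV
  | |- is_true (lip _ (_ + _) (_ + _)) => eapply lipD; lipr
  | |- is_true (lip _ (_ * _) (_ * _)) => eapply lipM; lipr
  | |- is_true (lip _ (- _) (- _)) => eapply lipN; lipr
  | |- is_true (lip _ (_ ^+ _) (_ ^+ _)) => eapply lipX; lipr
  | |- is_true (lip _ (_^-1) (_^-1)) => eapply lipV; [mem | mem | lipr]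
  end.

(* [lipr] leaves the exponent of [lip] to unification; [lipt] compares it with the given one. *)
Ltac lipt := eapply lip_le; cycle 1; [lipr | by []].

Lemma w_V0 : w^-1 != 0. Proof. by rewrite invr_eq0 w_neq0. Qed.

Ltac nzt := rewrite ?mulf_neq0 ?invr_eq0 ?expf_neq0 ?oner_neq0 ?w_neq0 //.

Ltac phil := eapply Phi_lip; [nzt | nzt | lipr | lipr | lipr | lipr | by [] | by [] | by [] | by []].
Ltac termlip := congr (_ *: _); [apply: chi_lip; [mem | lipt] | phil].

Ltac fld := field; repeat match goal with |- is_true (_ && _) => apply/andP; split end;
  first [done | exact: w_neq0 | exact: oner_neq0 | apply: unit_neq0; solve [mem] | idtac].
Ltac phieq := congr Phi; fld.

(** The middle block has second row (x/w, w), so its second entry dominates exactly when v(x) >=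
    2. *)
Lemma Ln_p2 x a b c : inp 2 x ->
  pi (Lm F x *m nm F w a b c) (pi (tau F w) v) =
  Phi 1 w^-1 (- (a + x * b / w) * w ^- 2) (b / w) c 0.
Proof.
move=> hx; have w0 := w_neq0; rewrite pi_Ln_tau.
have -> : Mid w^-1 0 (x / w) w = Mid ((1 + 0 * (x / w)) / w) 0 (x / w) w.
  by rewrite mul0r addr0 mul1r.
rewrite pi_Mid_Heis_D //; last first.
  have -> : x / w / w = x * w ^- 2 by fld.
  exact: inpM hx (inpXV 2).
phieq.
Qed.

Lemma Ln_p x a b c : isunit x ->
  pi (Lm F (w * x) *m nm F w a b c) (pi (tau F w) v) =
  Phi 1 1 (- (a + x * b) / w) (b * w ^- 2) c (x^-1 / w).
Proof.
move=> hx; have w0 := w_neq0; have x0 := unit_neq0 hx; rewrite pi_Ln_tau.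
have -> : Mid w^-1 0 (w * x / w) w = Mid w^-1 ((w^-1 * w - 1) / x) x w.
  by rewrite /Mid; apply: mk4_eq => //; fld.
rewrite pi_Mid_Heis_C //; last by mem.
rewrite (@Phi_norm 1 1 1 x^-1) ?oner_neq0 ?unit1 ?mulr1 ?mul1r //; [phieq | by mem].
Qed.

Lemma Ln_u x a b c : isunit x ->
  pi (Lm F x *m nm F w a b c) (pi (tau F w) v) =
  Phi 1 w (- (a + x * b / w)) (b * w ^- 3) c (x^-1 * w ^- 2).
Proof.
move=> hx; have w0 := w_neq0; have x0 := unit_neq0 hx; rewrite pi_Ln_tau.
have -> : Mid w^-1 0 (x / w) w = Mid w^-1 ((w^-1 * w - 1) / (x / w)) (x / w) w.
  by rewrite /Mid; apply: mk4_eq => //; fld.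
rewrite pi_Mid_Heis_C //; [| by rewrite mulf_neq0 ?w_V0 | ].
  rewrite (@Phi_norm 1 w 1 x^-1) ?oner_neq0 ?unit1 ?mulr1 //; [phieq | by fld | by mem].
have -> : w / (x / w) = w * w / x by fld.
by mem.
Qed.

(** The middle block has second row (-1/w, 0), so the first entry dominates for every y, and the
    torus part is the one found for unit x. *)
Lemma sLn y a b c : inp 1 y ->
  pi (s1 F *m Lm F y *m nm F w a b c) (pi (tau F w) v) =
  Phi 1 w (b / w) ((y * b + a * w) * w ^- 3) c (- y * w ^- 2).
Proof.
move=> hy; have w0 := w_neq0; rewrite pi_sLn_tau.
have -> : Mid (y / w) w (- w^-1) 0 = Mid (y / w) ((y / w * 0 - 1) / (- w^-1)) (- w^-1) 0.
  by rewrite /Mid; apply: mk4_eq => //; fld.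
rewrite pi_Mid_Heis_C ?oppr_eq0 ?w_V0 //; last by rewrite mul0r ino0.
rewrite (@Phi_norm 1 w 1 (-1)) ?oner_neq0 ?unit1 ?mulr1 //; [phieq | by fld | by mem].
Qed.

Lemma unit_div x : inp 1 x -> ~~ inp 2 x -> isunit (x / w).
Proof.
move=> h1 h2; apply: ino_unit; first exact: inp1_div.
apply: contra h2 => h; have := inpM h inp1w1.
by rewrite divfK ?w_neq0.
Qed.

Lemma Ln_lip z z' x x' b b' a a' s : lip 4 s s ->
  ino z -> ino z' -> ino x -> ino x' -> isunit b -> isunit b' -> isunit a -> isunit a' ->
  lip 0 z z' -> lip 0 x x' -> lip 0 b b' -> lip 0 a a' ->
  chi (a * b) *: pi (Lm F x *m nm F w a b (z * s)) (pi (tau F w) v) =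
  chi (a' * b') *: pi (Lm F x' *m nm F w a' b' (z' * s)) (pi (tau F w) v).
Proof.
move=> ls hz hz' hx hx' hb hb' ha ha' lz lx lb la.
case h2 : (inp 2 x).
  rewrite !Ln_p2 //; last exact: lip_inp lx.
  by termlip.
case h1 : (inp 1 x).
  have k1 := lip_inp1 h1 lx.
  have h2' : ~~ inp 2 x by rewrite h2.
  have k2' : ~~ inp 2 x' by apply: contra h2' => h; exact: lip_inp (lip_sym lx).
  have u := unit_div h1 h2'; have u' := unit_div k1 k2'.
  have w0 := w_neq0.
  have -> : x = w * (x / w) by fld.
  have -> : x' = w * (x' / w) by fld.
  rewrite !Ln_p //.
  (* Division by w costs one digit. *)
  have l : lip 1 (x / w) (x' / w) by lipt.
  by termlip.
have u : isunit x by apply: ino_unit; rewrite ?h1.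
have u' := lip_unit u lx.
by rewrite !Ln_u //; termlip.
Qed.

(** Integrands for v(x) >= 2, for v(x) = 1, and for unit x joined with the s_1 term. In the first
    two, x is the original variable divided by w; s is w^-4, or w^-3 in the terms to which t_4 is
    applied. *)
Definition fPa s (p : pt) : V := let: (z, x, b, a) := p in
  chi (a * b) *: Phi 1 w^-1 (- (a + x * b) * w ^- 2) (b / w) (z * s) 0.
Definition fPb s (p : pt) : V := let: (z, x, b, a) := p in
  chi (a * b) *: Phi 1 1 (- (a + x * b) / w) (b * w ^- 2) (z * s) (x^-1 / w).
Definition fPc s (p : pt) : V := let: (z, x, b, a) := p in
  chi (a * b) *: Phi 1 w (b / w) ((x * b + a * w) * w ^- 3) (z * s) (- x * w ^- 2).

Definition prodS (S1 S2 S3 S4 : pred F) : pred pt :=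
  fun '(z, x, b, a) => [&& S1 z, S2 x, S3 b & S4 a].

Lemma fPc_lip s p p' : lip 4 s s -> prodS ino ino isunit isunit p -> prodS ino ino isunit isunit p' ->
  lip4 p p' -> fPc s p = fPc s p'.
Proof.
case: p p' => [[[z x] b] a] [[[z' x'] b'] a'] ls /and4P[hz hx hb ha] /and4P[hz' hx' hb' ha'] /and4P[lz lx lb la].
by rewrite /fPc; termlip.
Qed.

Lemma domC (S S' : pred F) : dom S -> dom S' -> dom (fun x => S x && ~~ S' x).
Proof.
move=> [d p] [d' p']; split=> [x /andP[/d]//|x y /andP[h h'] l].
apply/andP; split; first exact: p l.
by apply: contra h' => h'; apply: p' h' (lip_sym l).
Qed.

(** Each rescaling of x by w costs 1/q. For unit x the substitution x -> -1/x gives [fPc] on units,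
    and the s_1 term is [fPc] on p. *)
Lemma S_pieces s : lip 4 s s ->
  E4 (prodS ino ino isunit isunit) (fun '(z, x, b, a) =>
       chi (a * b) *: pi (Lm F x *m nm F w a b (z * s)) (pi (tau F w) v)) +
  E4 (prodS ino (inp 1) isunit isunit) (fun '(z, x, b, a) =>
       chi (a * b) *: pi (s1 F *m Lm F x *m nm F w a b (z * s)) (pi (tau F w) v)) =
  Q^-1 *: E4 (prodS ino (inp 1) isunit isunit) (fPa s) +
  Q^-1 *: E4 (prodS ino isunit isunit isunit) (fPb s) +
  E4 (prodS ino ino isunit isunit) (fPc s).
Proof.
move=> ls; have w0 := w_neq0.
rewrite (E4_split (fun '(z, x, b, a) => inp 2 x)) -!addrA; congr (_ + _).
  rewrite E4_swap (@E4_pred _ (prodS (inp 2) ino isunit isunit)); last first.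
    case=> [[[x z] b] a] /and4P[hx hz hb ha] /=; rewrite hz hx /=.
    by case: (inp 2 x); rewrite /= ?andbT ?andbF.
  have p21 x : inp 2 x -> ino x by exact: inp_sub.
  rewrite E4_scale1; last first.
  - move=> [[[x z] b] a] [[[x' z'] b'] a'] /and4P[hx hz hb ha] /and4P[hx' hz' hb' ha'] /and4P[lx lz lb la].
    by apply: Ln_lip => //; exact: p21.
  - by case=> [[[x z] b] a] /andP[hx _]; apply: inp_sub hx.
  - by apply: dom4_prod; [exact: dom_p2|exact: dom_o|exact: dom_U|exact: dom_U].
  rewrite [E4 _ (fPa s)]E4_swap; congr (_ *: _).
  rewrite (@E4_pred _ (prodS (inp 1) ino isunit isunit)); last first.
    by case=> [[[x z] b] a] /and4P[hx hz hb ha] /=; rewrite hx hz hb ha -[w]expr1 inp_divX.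
  rewrite [RHS](@E4_pred _ (prodS (inp 1) ino isunit isunit)); last first.
    by case=> [[[x z] b] a] _ /=; case: (ino z); rewrite /= ?andbF.
  apply: eq_E4 => -[[[x z] b] a] _ /and4P[hx hz hb ha].
  rewrite Ln_p2; last by rewrite -[w]expr1 inp_divX.
  by congr (_ *: Phi _ _ _ _ _ _); fld.
rewrite (E4_split (fun '(z, x, b, a) => inp 1 x)) -!addrA; congr (_ + _).
  rewrite E4_swap (@E4_pred _ (prodS (fun x => inp 1 x && ~~ inp 2 x) ino isunit isunit)); last first.
    case=> [[[x z] b] a] /and4P[hx hz hb ha] /=; rewrite hz hx /=.
    by case: (inp 2 x); case: (inp 1 x); rewrite /= ?andbT ?andbF.
  rewrite E4_scale1; last first.
  - move=> [[[x z] b] a] [[[x' z'] b'] a'] /and4P[/andP[hx _] hz hb ha] /and4P[/andP[hx' _] hz' hb' ha'] /and4P[lx lz lb la].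
    by apply: Ln_lip => //; exact: inp1_ino.
  - by case=> [[[x z] b] a] /andP[/andP[]].
  - by apply: dom4_prod; [apply: (domC dom_p dom_p2)|exact: dom_o|exact: dom_U|exact: dom_U].
  rewrite [E4 _ (fPb s)]E4_swap; congr (_ *: _).
  rewrite (@E4_pred _ (prodS isunit ino isunit isunit)); last first.
    case=> [[[x z] b] a] /and4P[hx hz hb ha] /=; rewrite hx hz hb ha inp1w hx -[w]expr1 inp_divX /=.
    by rewrite (unitE x) hx.
  rewrite [RHS](@E4_pred _ (prodS isunit ino isunit isunit)); last first.
    by case=> [[[x z] b] a] _ /=; case: (ino z); rewrite /= ?andbF.
  apply: eq_E4 => -[[[x z] b] a] _ /and4P[hx hz hb ha].
  by rewrite Ln_p.
rewrite addrC [RHS](E4_split (fun '(z, x, b, a) => inp 1 x)); congr (_ + _).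
  rewrite [RHS](@E4_pred _ (prodS ino (inp 1) isunit isunit)); last first.
    case=> [[[z x] b] a] /and4P[hz hx hb ha] /=; rewrite hz hx /=.
    by case: (inp 1 x); rewrite /= ?andbT ?andbF.
  by apply: eq_E4 => -[[[z x] b] a] _ /and4P[hz hx hb ha]; rewrite sLn.
rewrite (@E4_pred _ (prodS ino isunit isunit isunit)); last first.
  case=> [[[z x] b] a] /and4P[hz hx hb ha] /=; rewrite hz hx (unitE x) hx /=.
  have : inp 2 x -> inp 1 x by exact: inp_sub.
  by case: (inp 2 x); case: (inp 1 x) => //= h; rewrite ?andbT ?andbF //; case: (h isT).
rewrite [RHS](@E4_pred _ (prodS ino isunit isunit isunit)); last first.
  case=> [[[z x] b] a] /and4P[hz hx hb ha] /=; rewrite hz hx (unitE x) hx /=.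
  by case: (inp 1 x); rewrite ?andbT ?andbF.
have dU : dom4 (prodS ino isunit isunit isunit).
  by apply: dom4_prod; [exact: dom_o|exact: dom_U|exact: dom_U|exact: dom_U].
(* The images of b and a are read off from the first two Heisenberg coordinates. *)
apply: (@E4_bij _ _ _ _ (fun '(z, x, b, a) => (z, - x^-1, - (a * w + x * b), - a / x))
                        (fun '(z, x, b, a) => (z, - x^-1, x * b + a * w, a / x))) => //.
- by case=> [[[z x] b] a] /and4P[hz hx hb ha]; apply/and4P; split; mem.
- by case=> [[[z x] b] a] /and4P[hz hx hb ha]; apply/and4P; split; mem.
- by case=> [[[z x] b] a] /and4P[hz hx hb ha]; congr (_, _, _, _); fld.
- by case=> [[[z x] b] a] /and4P[hz hx hb ha]; congr (_, _, _, _); fld.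
- case=> [[[z x] b] a] [[[z' x'] b'] a'] /and4P[hz hx hb ha] /and4P[hz' hx' hb' ha'] /and4P[lz lx lb la].
  by apply/and4P; split; lipt.
- case=> [[[z x] b] a] [[[z' x'] b'] a'] /and4P[hz hx hb ha] /and4P[hz' hx' hb' ha'] /and4P[lz lx lb la].
  by apply/and4P; split; lipt.
- move=> [[[z x] b] a] [[[z' x'] b'] a'] /and4P[hz hx hb ha] /and4P[hz' hx' hb' ha'] l.
  by apply: fPc_lip => //; apply/and4P; split => //; exact: unit_ino.
- case=> [[[z x] b] a] /and4P[hz hx hb ha]; rewrite Ln_u // /fPc.
  congr (_ *: _); last by phieq.
  apply: (@chi_eq 1); [mem|mem|].
  have -> : - a / x * - (a * w + x * b) - a * b * 1 ^+ 2 = a ^+ 2 * w / x by fld.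
  mem.
Qed.

(** * The vectors T^k as fourfold sums *)

Local Notation U1 := (unit_not1 F vo).

Lemma piZ g (c : K) u : pi g (c *: u) = c *: pi g u.
Proof.
have l := rep_linear _ _ _ _ _ hpi g; have := l c u 0; rewrite addr0 => ->.
by have := l (-1) 0 0; rewrite scaler0 add0r scaleN1r addNr => ->; rewrite addr0.
Qed.

Lemma pi_E4 g (S : pred pt) (f : pt -> V) : pi g (E4 S f) = E4 S (fun p => pi g (f p)).
Proof. exact: E4_linear (rep_linear _ _ _ _ _ hpi g). Qed.

Ltac dom_tac := first [exact: dom_o | exact: dom_U | exact: dom_U1 | exact: dom_p].
Ltac unU1 := repeat match goal with
  H : is_true (unit_not1 _ _ ?z) |- _ => case: (U1P H) => ? ?; clear H end.
Ltac per_tac := intros; unU1; rewrite ?pi_XY ?pi_Y; termlip.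
Ltac flip_tac f :=
  move=> [[[? ?] ?] ?] [[[? ?] ?] ?] /and4P[? ? ? ?] /and4P[? ? ? ?] /and4P[? ? ? ?];
  rewrite /f; unU1; termlip.
Ltac Tform_tac f0 :=
  rewrite ?piZ ?pi_E4 ?scalerA;
  lazymatch goal with |- ?L = ?R => lazymatch L with context[E4 ?S ?f] => lazymatch R with context[E4 ?S' ?f'] =>
    rewrite (_ : E4 S f = E4 S' f');
    [ try (congr (_ *: _); field; rewrite ?Q_neq0 //)
    | apply: eq_E4 => -[[[? ?] ?] ?] _ /and4P[? ? ? ?];
      rewrite /f0 ?piZ ?pi_XY ?pi_Y ?etaE ?tauE ?tauiE ?pi_Tor_Phi; nzt; congr (_ *: _);
      congr Phi; rewrite ?mulr1 ?mul1r -?invfM -?expr2 // ] end end end.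

(** Integrands of the T^k with the outer powers of eta and tau moved into d1 and d2. The variables
    keep the order of the iterated integrals, dummies last. *)
Definition fT1 (p : pt) : V := let: (z, x, b, a) := p in
  chi (a * b) *: Phi 1 1 (- (a + x * b) * w^-1) (b * w ^- 2) ((z * w ^- 4) + (- (a + x * b) * w^-1) * (b * w ^- 2)) (x^-1 * w^-1).
Definition fT2 (p : pt) : V := let: (y, b, a, x) := p in
  chi (a * b * x * y) *: Phi w^-1 1 (b * w^-1) (- a * w ^- 2) ((a * b * (1 - (1 - y)^-1 * x) * w ^- 3) + (b * w^-1) * (- a * w ^- 2)) (a * b^-1 * (1 - x)^-1 * w^-1).
Definition fT3 (p : pt) : V := let: (z, b, a, d) := p in
  chi (b * (1 - z)) *: Phi w^-1 1 0 (a * w ^- 2) (b * w ^- 3) (a ^+ 2 * b^-1 * z * w^-1).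
Definition fT4 (p : pt) : V := let: (x, b, a, d) := p in
  chi b *: Phi w^-1 1 (x * w ^- 2) (a * w ^- 2) (((b * w - a * x) * w ^- 4) + (x * w ^- 2) * (a * w ^- 2)) 0.
Definition fT5 (p : pt) : V := let: (x, b, a, d) := p in
  chi b *: Phi w^-1 1 (x * w^-1) (a * w ^- 2) (((b - a * x) * w ^- 3) + (x * w^-1) * (a * w ^- 2)) 0.
Definition fT6 (p : pt) : V := let: (x, b, a, d) := p in
  chi (b * x) *: Phi (w ^- 2) 1 0 (a * w ^- 2) (b * (1 - x * w) * w ^- 2) (a ^+ 2 * b^-1 * w ^- 2).
Definition fT7 (p : pt) : V := let: (z, b, a, d) := p in
  chi (a * b) *: Phi 1 w^-1 (- a * w ^- 2) (b * w^-1) ((z * w ^- 4) + (- a * w ^- 2) * (b * w^-1)) 0.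
Definition fT8 (p : pt) : V := let: (z, b, a, d) := p in
  chi (a * b * z * (1 - z)) *: Phi w^-1 w^-1 (b * w ^- 2) (a * w^-1) ((- (a * b * (1 - z)) * w ^- 3) + (b * w ^- 2) * (a * w^-1)) 0.
Definition fT9 (p : pt) : V := let: (x, b, a, d) := p in
  chi b *: Phi (w ^- 2) w^-1 (a * w^-1) 0 ((- b * w^-1) + (a * w^-1) * 0) (x * w^-1).
Definition fT10 (p : pt) : V := let: (b, a, d, d') := p in
  chi b *: Phi (w ^- 2) (w ^- 2) (a * w ^- 2) 0 ((- b * w^-1) + (a * w ^- 2) * 0) 0.
Definition fT11 (p : pt) : V := let: (z, x, b, a) := p in
  chi (a * b) *: Phi 1 w (b * w^-1) ((x * b + a * w) * w ^- 3) ((z * w ^- 4) + (b * w^-1) * ((x * b + a * w) * w ^- 3)) (- x * w ^- 2).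
Definition fT12 (p : pt) : V := let: (z, y, b, a) := p in
  chi (a * b * z * (1 - z)) *: Phi w^-1 w (a * w^-1) (y * w ^- 3) ((a * (b * (1 - z) * w - y) * w ^- 4) + (a * w^-1) * (y * w ^- 3)) (- (a^-1 * (y + b * w)) * w ^- 2).
Definition fT13 (p : pt) : V := let: (x, b, a, d) := p in
  chi (b * x) *: Phi (w ^- 2) w 0 (a * w ^- 2) (b * (1 - x) * w^-1) (a ^+ 2 * b^-1 * w ^- 3).
Definition fT14 (p : pt) : V := let: (x, b, a, d) := p in
  chi b *: Phi (w ^- 2) (w ^+ 2) 0 (a * w ^- 2) (- b * w^-1) (x * w ^- 4).

Lemma fT1_lip p p' : prodS ino isunit isunit isunit p -> prodS ino isunit isunit isunit p' -> lip4 p p' -> fT1 p = fT1 p'.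
Proof. by move: p p'; flip_tac fT1. Qed.

Lemma T1E : T1 F vo w K V q R chi pi v = Q ^+ 2 *: E4 (prodS ino isunit isunit isunit) fT1.
Proof.
rewrite /T1 /intO /intU /intU1 /Qk integ4E; [|dom_tac..|by per_tac].
Tform_tac fT1.
Qed.

Lemma fT2_lip p p' : prodS U1 isunit isunit U1 p -> prodS U1 isunit isunit U1 p' -> lip4 p p' -> fT2 p = fT2 p'.
Proof. by move: p p'; flip_tac fT2. Qed.

Lemma T2E : T2 F vo w K V q R chi pi v = Q *: E4 (prodS U1 isunit isunit U1) fT2.
Proof.
rewrite /T2 /intO /intU /intU1 /Qk integ4E; [|dom_tac..|by per_tac].
Tform_tac fT2.
Qed.

Lemma fT3_lip p p' : prodS U1 isunit isunit (inp 1) p -> prodS U1 isunit isunit (inp 1) p' -> lip4 p p' -> fT3 p = fT3 p'.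
Proof. by move: p p'; flip_tac fT3. Qed.

Lemma T3E : T3 F vo w K V q R chi pi v = Q *: E4 (prodS U1 isunit isunit (inp 1)) fT3.
Proof.
rewrite /T3 /intO /intU /intU1 /Qk integ3E; [|dom_tac..|by per_tac].
Tform_tac fT3.
Qed.

Lemma fT4_lip p p' : prodS isunit isunit ino (inp 1) p -> prodS isunit isunit ino (inp 1) p' -> lip4 p p' -> fT4 p = fT4 p'.
Proof. by move: p p'; flip_tac fT4. Qed.

Lemma T4E : T4 F vo w K V q R chi pi v = Q ^+ 2 *: E4 (prodS isunit isunit ino (inp 1)) fT4.
Proof.
rewrite /T4 /intO /intU /intU1 /Qk integ3E; [|dom_tac..|by per_tac].
Tform_tac fT4.
Qed.

Lemma fT5_lip p p' : prodS ino isunit isunit (inp 1) p -> prodS ino isunit isunit (inp 1) p' -> lip4 p p' -> fT5 p = fT5 p'.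
Proof. by move: p p'; flip_tac fT5. Qed.

Lemma T5E : T5 F vo w K V q R chi pi v = Q *: E4 (prodS ino isunit isunit (inp 1)) fT5.
Proof.
rewrite /T5 /intO /intU /intU1 /Qk integ3E; [|dom_tac..|by per_tac].
Tform_tac fT5.
Qed.

Lemma fT6_lip p p' : prodS isunit isunit isunit (inp 1) p -> prodS isunit isunit isunit (inp 1) p' -> lip4 p p' -> fT6 p = fT6 p'.
Proof. by move: p p'; flip_tac fT6. Qed.

Lemma T6E : T6 F vo w K V q R chi pi v = 1 *: E4 (prodS isunit isunit isunit (inp 1)) fT6.
Proof.
rewrite /T6 /intO /intU /intU1 /Qk integ3E; [|dom_tac..|by per_tac].
Tform_tac fT6.
Qed.

Lemma fT7_lip p p' : prodS ino isunit isunit (inp 1) p -> prodS ino isunit isunit (inp 1) p' -> lip4 p p' -> fT7 p = fT7 p'.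
Proof. by move: p p'; flip_tac fT7. Qed.

Lemma T7E : T7 F vo w K V q R chi pi v = Q ^+ 2 *: E4 (prodS ino isunit isunit (inp 1)) fT7.
Proof.
rewrite /T7 /intO /intU /intU1 /Qk integ3E; [|dom_tac..|by per_tac].
Tform_tac fT7.
Qed.

Lemma fT8_lip p p' : prodS U1 isunit isunit (inp 1) p -> prodS U1 isunit isunit (inp 1) p' -> lip4 p p' -> fT8 p = fT8 p'.
Proof. by move: p p'; flip_tac fT8. Qed.

Lemma T8E : T8 F vo w K V q R chi pi v = Q *: E4 (prodS U1 isunit isunit (inp 1)) fT8.
Proof.
rewrite /T8 /intO /intU /intU1 /Qk integ3E; [|dom_tac..|by per_tac].
Tform_tac fT8.
Qed.

Lemma fT9_lip p p' : prodS isunit isunit isunit (inp 1) p -> prodS isunit isunit isunit (inp 1) p' -> lip4 p p' -> fT9 p = fT9 p'.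
Proof. by move: p p'; flip_tac fT9. Qed.

Lemma T9E : T9 F vo w K V q R chi pi v = Q^-1 *: E4 (prodS isunit isunit isunit (inp 1)) fT9.
Proof.
rewrite /T9 /intO /intU /intU1 /Qk integ3E; [|dom_tac..|by per_tac].
Tform_tac fT9.
Qed.

Lemma fT10_lip p p' : prodS isunit isunit (inp 1) (inp 1) p -> prodS isunit isunit (inp 1) (inp 1) p' -> lip4 p p' -> fT10 p = fT10 p'.
Proof. by move: p p'; flip_tac fT10. Qed.

Lemma T10E : T10 F vo w K V q R chi pi v = Q^-1 *: E4 (prodS isunit isunit (inp 1) (inp 1)) fT10.
Proof.
rewrite /T10 /intO /intU /intU1 /Qk integ2E; [|dom_tac..|by per_tac].
Tform_tac fT10.
Qed.

Lemma fT11_lip p p' : prodS ino ino isunit isunit p -> prodS ino ino isunit isunit p' -> lip4 p p' -> fT11 p = fT11 p'.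
Proof. by move: p p'; flip_tac fT11. Qed.

Lemma T11E : T11 F vo w K V q R chi pi v = Q ^+ 3 *: E4 (prodS ino ino isunit isunit) fT11.
Proof.
rewrite /T11 /intO /intU /intU1 /Qk integ4E; [|dom_tac..|by per_tac].
Tform_tac fT11.
Qed.

Lemma fT12_lip p p' : prodS U1 ino isunit isunit p -> prodS U1 ino isunit isunit p' -> lip4 p p' -> fT12 p = fT12 p'.
Proof. by move: p p'; flip_tac fT12. Qed.

Lemma T12E : T12 F vo w K V q R chi pi v = Q ^+ 2 *: E4 (prodS U1 ino isunit isunit) fT12.
Proof.
rewrite /T12 /intO /intU /intU1 /Qk integ4E; [|dom_tac..|by per_tac].
Tform_tac fT12.
Qed.

Lemma fT13_lip p p' : prodS isunit isunit isunit (inp 1) p -> prodS isunit isunit isunit (inp 1) p' -> lip4 p p' -> fT13 p = fT13 p'.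
Proof. by move: p p'; flip_tac fT13. Qed.

Lemma T13E : T13 F vo w K V q R chi pi v = Q *: E4 (prodS isunit isunit isunit (inp 1)) fT13.
Proof.
rewrite /T13 /intO /intU /intU1 /Qk integ3E; [|dom_tac..|by per_tac].
Tform_tac fT13.
Qed.

Lemma fT14_lip p p' : prodS ino isunit isunit (inp 1) p -> prodS ino isunit isunit (inp 1) p' -> lip4 p p' -> fT14 p = fT14 p'.
Proof. by move: p p'; flip_tac fT14. Qed.

Lemma T14E : T14 F vo w K V q R chi pi v = Q ^+ 2 *: E4 (prodS ino isunit isunit (inp 1)) fT14.
Proof.
rewrite /T14 /intO /intU /intU1 /Qk integ3E; [|dom_tac..|by per_tac].
Tform_tac fT14.
Qed.

Ltac brk := repeat match goal with H : is_true (_ && _) |- _ => case/andP: H => ? ? end.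

Ltac spl := rewrite ?/prodS /=; repeat match goal with |- is_true (_ && _) => apply/andP; split end.

Ltac trans_tac := spl;
  match goal with
  | |- is_true (Defs.isunit _ _ _) =>
      match goal with H : is_true (Defs.isunit _ _ _) |- _ => apply: (lip_unit H); solve [lipt] end
  | |- is_true (Defs.inp _ _ 1 _) =>
      match goal with H : is_true (Defs.inp _ _ 1 _) |- _ => apply: (lip_inp1 H); solve [lipt] end
  | H : is_true (lip 0 ?x ?y) |- is_true (Defs.ino _ _ ?y) => by rewrite (lip0_ino H)
  end.

Ltac dom4_tac :=
  split=> [[[[? ?] ?] ?]|[[[? ?] ?] ?] [[[? ?] ?] ?]];
  [ rewrite /prodS /ino4 /= => ?; brk; unU1; spl; mem
  | rewrite /prodS /lip4 /= => ? ?; brk; unU1; spl; try apply: U1I; trans_tac ].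

Ltac lip4_tac :=
  move=> [[[? ?] ?] ?] [[[? ?] ?] ?]; rewrite /prodS /lip4 /= => ? ? ?; brk; unU1; spl; lipt.

Ltac bij_goal := move=> [[[? ?] ?] ?]; rewrite /prodS /= => ?; brk; unU1; spl; try apply: U1I.
Ltac map_tac := bij_goal; mem.
Ltac inv_tac := bij_goal; congr (_, _, _, _); fld.

Lemma lip_s4 : lip 4 (w ^- 4) (w ^- 4). Proof. exact: lip_wXV. Qed.
Lemma lip_s3 : lip 4 (w ^- 3) (w ^- 3). Proof. exact: lip_le (lip_wXV 3). Qed.

(** For x in p the coset sees x only through a + x*b, which becomes the new a, and x becomes the
    dummy; chi does not distinguish a from a + x*b. The shift of z absorbs the term s*r in the
    formula for X(s)Y(r,s',t). *)
Lemma Pa4_T7 : E4 (prodS ino (inp 1) isunit isunit) (fPa (w ^- 4)) =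
               E4 (prodS ino isunit isunit (inp 1)) fT7.
Proof.
apply: (@E4_bij _ _ _ _ (fun '(z, x, b, a) => (z + (a + x * b) * b * w, b, a + x * b, x))
  (fun '(z, b, a, x) => (z - a * b * w, x, b, a - x * b))).
- dom4_tac.
- dom4_tac.
- map_tac.
- map_tac.
- inv_tac.
- inv_tac.
- lip4_tac.
- lip4_tac.
- exact: fT7_lip.
- case=> [[[z x] b] a] /and4P[hz hx hb ha]; rewrite /fPa /fT7; congr (_ *: _); last by phieq.
  apply: (@chi_eq 1); [mem | mem | rewrite expr1n mulr1].
  by have -> : (a + x * b) * b - a * b = x * (b * b) by [ring]; mem.
Qed.

Lemma Pb4_T1 : E4 (prodS ino isunit isunit isunit) (fPb (w ^- 4)) =
               E4 (prodS ino isunit isunit isunit) fT1.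
Proof.
apply: (@E4_bij _ _ _ _ (fun '(z, x, b, a) => (z + (a + x * b) * b * w, x, b, a))
  (fun '(z, x, b, a) => (z - (a + x * b) * b * w, x, b, a))).
- dom4_tac.
- dom4_tac.
- map_tac.
- map_tac.
- inv_tac.
- inv_tac.
- lip4_tac.
- lip4_tac.
- exact: fT1_lip.
- by case=> [[[z x] b] a] /and4P[hz hx hb ha]; rewrite /fPb /fT1; congr (_ *: _); phieq.
Qed.

Lemma Pc4_T11 : E4 (prodS ino ino isunit isunit) (fPc (w ^- 4)) =
                E4 (prodS ino ino isunit isunit) fT11.
Proof.
apply: (@E4_bij _ _ _ _ (fun '(z, x, b, a) => (z - b * (x * b + a * w), x, b, a))
  (fun '(z, x, b, a) => (z + b * (x * b + a * w), x, b, a))).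
- dom4_tac.
- dom4_tac.
- map_tac.
- map_tac.
- inv_tac.
- inv_tac.
- lip4_tac.
- lip4_tac.
- exact: fT11_lip.
- by case=> [[[z x] b] a] /and4P[hz hx hb ha]; rewrite /fPc /fT11; congr (_ *: _); phieq.
Qed.

(** * Iwasawa decompositions after t_4 *)

Ltac nz := repeat match goal with
  | |- is_true (_ * _ != 0) => apply: mulf_neq0
  | |- is_true (_^-1 != 0) => rewrite invr_eq0
  | |- is_true (_ ^+ _ != 0) => apply: expf_neq0
  | |- is_true (- _ != 0) => rewrite oppr_eq0
  end; first [exact: w_neq0 | exact: oner_neq0 | apply: unit_neq0; solve [mem]].
Ltac fldn := field; repeat match goal with |- is_true (_ && _) => apply/andP; split end;
  first [done | nz | idtac].
Ltac phie := congr Phi; fldn.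
Ltac ino_as e := match goal with |- is_true (Defs.ino _ _ ?x) => rewrite (_ : x = e); [mem | fldn] end.

(** Here m + l*t = a w^-2, so D = (z + a*b)/z, while C = b^2 w/z lies in p: D dominates if z + a*b
    is a unit, and C otherwise. *)
Lemma t4_T12 z x b a : isunit z -> ino x -> isunit b -> isunit a -> isunit (z + a * b) ->
  pi (t4 F w) (Phi 1 w (b / w) ((x * b + a * w) * w ^- 3) (z * w ^- 3) (- x * w ^- 2)) =
  Phi w^-1 w (b / z / w) ((x * b + a * w) / z * w ^- 3) (- z^-1 * w ^- 3)
    (- (x + a ^+ 2 * w / (z + a * b)) * w ^- 2).
Proof.
move=> hz hx hb ha he.
rewrite (@Phi_t4_D_unit ((z + a * b) / z) w^-1 w z^-1 (z / (z + a * b))).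
- phie.
- fldn.
- fldn.
- fldn.
- mem.
- mem.
- nz.
- nz.
- nz.
- ino_as (w ^+ 3 / z).
- ino_as (b * w ^+ 2 / z).
- ino_as (a * w / z).
- ino_as (b ^+ 2 * w / (z + a * b)).
Qed.

Lemma t4_T4 z x b a : isunit z -> ino x -> isunit b -> isunit a -> inp 1 (z + a * b) ->
  pi (t4 F w) (Phi 1 w (b / w) ((x * b + a * w) * w ^- 3) (z * w ^- 3) (- x * w ^- 2)) =
  Phi w^-1 1 (b / z * w ^- 2) ((x * b + a * w) / z * w ^- 2) (- z^-1 * w ^- 3) 0.
Proof.
move=> hz hx hb ha he.
rewrite (@Phi_t4_C_unit (b ^+ 2 * w / z) ((z + a * b) / z) w^-1 1 z^-1 (z / b ^+ 2)).
(* The t coordinate is integral here and may be replaced by 0. *)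
- rewrite (@Phi_t _ _ _ _ _ _ 0); [phie | nz | nz | ].
  ino_as (- (z / b ^+ 2 * (w - b * (x * b + a * w) / z))).
- fldn.
- fldn.
- fldn.
- fldn.
- mem.
- mem.
- nz.
- nz.
- nz.
- ino_as (w ^+ 3 / z).
- ino_as (b * w ^+ 2 / z).
- ino_as (a * w / z).
- match goal with |- is_true (Defs.ino _ _ ?x) => rewrite (_ : x = (z + a * b) / w / b ^+ 2) end; last fldn.
  by apply: inoM; [exact: inp1_div | mem].
Qed.

(** For z in p the inverse of k may fail to be integral. Since m + l*t = a w^-2, translating l by
    (z/w - 1)/a makes k equal to w^-2; it replaces b by b1 with w + a*b1 = z + a*b. *)
Lemma t4_T14 z x b a : inp 1 z -> ino x -> isunit b -> isunit a ->
  pi (t4 F w) (Phi 1 w (b / w) ((x * b + a * w) * w ^- 3) (z * w ^- 3) (- x * w ^- 2)) =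
  Phi (w ^- 2) (w ^+ 2) 0 (a / (z + a * b) * w ^- 2) (- (z + a * b)^-1 / w)
    (- (x + a ^+ 2 * w / (z + a * b)) * w ^- 4).
Proof.
move=> hz hx hb ha; have he : isunit (z + a * b) by mem.
have hzw := inp1_div hz.
rewrite (@Phi_H _ _ _ _ _ _ ((z / w - 1) / a) 0 0); [|nz|nz|mem|mem|mem].
set b1 := b + (z - w) / a; have hb1 : isunit b1 by rewrite /b1; mem.
have e1 : w + a * b1 = z + a * b by rewrite /b1; fldn.
have he1 : isunit (w + a * b1) by rewrite e1.
rewrite (_ : Phi _ _ _ _ _ _ = Phi 1 w (b1 / w) ((x * b1 + a * w) * w ^- 3) (w ^- 2) (- x * w ^- 2)); last first.
  by rewrite /b1; phie.
rewrite -e1; clearbody b1.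
rewrite (@Phi_t4_D_unit ((w + a * b1) / w) (w ^- 2) (w ^+ 2) 1 (w + a * b1)^-1).
(* The l coordinate has become b1, which is integral and is translated to 0. *)
- rewrite (@Phi_H _ _ _ _ _ _ (- b1) 0 0); [phie|nz|nz|mem|mem|mem].
- fldn.
- fldn.
- fldn.
- mem.
- mem.
- nz.
- nz.
- nz.
- ino_as (w ^+ 2).
- ino_as (b1 * w).
- ino_as a.
- ino_as (b1 ^+ 2 * w / (w + a * b1)).
Qed.

(** Here m + l*t = -(a/x) w^-2, so D = (x*z + a*(a + x*b))/(x*z), while C = (a + x*b)^2 w/z lies in
    p. *)
Lemma t4_R1 z x b a : isunit z -> isunit x -> isunit b -> isunit a ->
  isunit (x * z + a * (a + x * b)) ->
  pi (t4 F w) (Phi 1 1 (- (a + x * b) / w) (b * w ^- 2) (z * w ^- 3) (x^-1 / w)) =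
  Phi w^-1 1 (- ((a + x * b) / z) / w) (b / z * w ^- 2) (- z^-1 * w ^- 3)
    ((z + a * b) / (x * z + a * (a + x * b)) / w).
Proof.
move=> hz hx hb ha he.
rewrite (@Phi_t4_D_unit ((x * z + a * (a + x * b)) / (x * z)) w^-1 1 z^-1 (x * z / (x * z + a * (a + x * b)))).
- phie.
- fldn.
- fldn.
- fldn.
- mem.
- mem.
- nz.
- nz.
- nz.
- ino_as (w ^+ 3 / z).
- ino_as (- (a + x * b) * w ^+ 2 / z).
- ino_as (- a / x * w / z).
- ino_as ((a + x * b) ^+ 2 * w * x / (x * z + a * (a + x * b))).
Qed.

(** Now C has valuation -1 and D = (z - a*b)/z is integral, so C always dominates. *)
Lemma t4_C2 z b a : isunit z -> isunit b -> isunit a ->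
  pi (t4 F w) (Phi 1 w^-1 (- a * w ^- 2) (b / w) (z * w ^- 3) 0) =
  Phi w^-1 1 (- (a / z) / w) (b / z * w ^- 2) (- z^-1 * w ^- 3) ((z + a * b) / a ^+ 2 / w).
Proof.
move=> hz hb ha.
rewrite (@Phi_t4_C_unit (a ^+ 2 / (z * w)) ((z - a * b) / z) w^-1 1 z^-1 (z / a ^+ 2)).
- phie.
- fldn.
- fldn.
- fldn.
- fldn.
- mem.
- mem.
- nz.
- nz.
- nz.
- ino_as (w ^+ 3 / z).
- ino_as (- a * w / z).
- ino_as (b * w ^+ 2 / z).
- ino_as ((z - a * b) * w / a ^+ 2).
Qed.

Lemma t4_T8 z x b a : isunit z -> isunit x -> isunit b -> isunit a -> isunit (a + x * b) ->
  inp 1 (x * z + a * (a + x * b)) ->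
  pi (t4 F w) (Phi 1 1 (- (a + x * b) / w) (b * w ^- 2) (z * w ^- 3) (x^-1 / w)) =
  Phi w^-1 w^-1 (- ((a + x * b) / z) * w ^- 2) (b / z / w) (- z^-1 * w ^- 3) 0.
Proof.
move=> hz hx hb ha hu he.
rewrite (@Phi_t4_C_unit ((a + x * b) ^+ 2 * w / z) ((x * z + a * (a + x * b)) / (x * z)) w^-1 w^-1 z^-1 (z / (a + x * b) ^+ 2)).
- rewrite (@Phi_t _ _ _ _ _ _ 0); [phie | nz | nz | ].
  ino_as (- ((z + (a + x * b) * b) * w / (a + x * b) ^+ 2)).
- fldn.
- fldn.
- fldn.
- fldn.
- mem.
- mem.
- nz.
- nz.
- nz.
- ino_as (w ^+ 3 / z).
- ino_as (- (a + x * b) * w ^+ 2 / z).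
- ino_as (- a / x * w / z).
- match goal with |- is_true (Defs.ino _ _ ?y) =>
    rewrite (_ : y = (x * z + a * (a + x * b)) / w / (x * (a + x * b) ^+ 2)) end; last fldn.
  by apply: inoM; [exact: inp1_div | mem].
Qed.

(** The normalisation of k to w^-2 is that of [t4_T14], except that l is large and t = 0, so m is
    translated instead. *)
Lemma t4_T13a z b a : inp 1 z -> isunit b -> isunit a ->
  pi (t4 F w) (Phi 1 w^-1 (- a * w ^- 2) (b / w) (z * w ^- 3) 0) =
  Phi (w ^- 2) w 0 (- a^-1 * w ^- 2) 0 ((z + a * b) / a ^+ 2 * w ^- 3).
Proof.
move=> hz hb ha; have hzw := inp1_div hz.
rewrite (@Phi_H _ _ _ _ _ _ 0 ((z / w - 1) / a) 0); [|nz|nz|mem|mem|mem].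
set b1 := b + (z - w) / a; have hb1 : isunit b1 by rewrite /b1; mem.
have e1 : w + a * b1 = z + a * b by rewrite /b1; fldn.
rewrite (_ : Phi _ _ _ _ _ _ = Phi 1 w^-1 (- a * w ^- 2) (b1 / w) (w ^- 2) 0); last first.
  by rewrite /b1; phie.
rewrite -e1; clearbody b1.
rewrite (@Phi_t4_C_unit (a ^+ 2 / w ^+ 2) ((w - a * b1) / w) (w ^- 2) w 1 (a ^- 2)).
- rewrite (@Phi_H _ _ _ _ _ _ a 0 0); [phie|nz|nz|mem|mem|mem].
- fldn.
- fldn.
- fldn.
- fldn.
- mem.
- mem.
- nz.
- nz.
- nz.
- ino_as (w ^+ 2).
- ino_as (- a).
- ino_as (b1 * w).
- ino_as ((w - a * b1) * w / a ^+ 2).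
Qed.

Lemma t4_T13b z x b a : inp 1 z -> isunit x -> isunit b -> isunit a -> isunit (a + x * b) ->
  pi (t4 F w) (Phi 1 1 (- (a + x * b) / w) (b * w ^- 2) (z * w ^- 3) (x^-1 / w)) =
  Phi (w ^- 2) w 0 (- (a / (x * z + a * (a + x * b))) * w ^- 2)
    (- (x / (x * z + a * (a + x * b))) / w)
    ((z + a * b) / (x * z + a * (a + x * b)) * w ^- 3).
Proof.
move=> hz hx hb ha hu; have hzw := inp1_div hz.
have he : isunit (x * z + a * (a + x * b)) by mem.
(* As m + l*t = -(a/x) w^-2, this adds (1 - z/w) w^-2 to k, which becomes w^-2. *)
rewrite (@Phi_H _ _ _ _ _ _ ((1 - z / w) * x / a) 0 0); [|nz|nz|mem|mem|mem].
set b1 := b + (z - w) / a.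
have e1 : w + a * b1 = z + a * b by rewrite /b1; fldn.
have e2 : x * w + a * (a + x * b1) = x * z + a * (a + x * b) by rewrite /b1; fldn.
have hu1 : ino (a + x * b1) by rewrite /b1; mem.
have he1 : isunit (x * w + a * (a + x * b1)) by rewrite e2.
rewrite (_ : Phi _ _ _ _ _ _ = Phi 1 1 (- (a + x * b1) / w) (b1 * w ^- 2) (w ^- 2) (x^-1 / w)); last first.
  by rewrite /b1; phie.
rewrite -e1 -e2; clearbody b1.
rewrite (@Phi_t4_D_unit ((x * w + a * (a + x * b1)) / (x * w)) (w ^- 2) w 1 (x / (x * w + a * (a + x * b1)))).
- rewrite (@Phi_H _ _ _ _ _ _ (a + x * b1) 0 0); [phie|nz|nz|mem|mem|mem].
- fldn.
- fldn.
- fldn.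
- mem.
- mem.
- nz.
- nz.
- nz.
- ino_as (w ^+ 2).
- ino_as (- (a + x * b1) * w).
- ino_as (- a / x).
- ino_as ((a + x * b1) ^+ 2 * (x * w) / (x * w + a * (a + x * b1))).
Qed.

Lemma Phi_R4 z x b a : inp 1 z -> isunit x -> isunit b -> isunit a -> inp 1 (a + x * b) ->
  Phi 1 1 (- (a + x * b) / w) (b * w ^- 2) (z * w ^- 3) (x^-1 / w) =
  Phi 1 1 0 (- (a / x) * w ^- 2) ((z + (a + x * b) * a / x) * w ^- 3) (x^-1 / w).
Proof.
move=> hz hx hb ha hu; have huw := inp1_div hu.
by rewrite (@Phi_H _ _ _ _ _ _ ((a + x * b) / w) 0 0); [phie|nz|nz|mem|mem|mem].
Qed.

Lemma t4_T6 z x b : isunit z -> isunit x -> isunit b ->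
  pi (t4 F w) (Phi 1 1 0 (b * w ^- 2) (z * w ^- 2) (x^-1 / w)) =
  Phi (w ^- 2) 1 0 (b / z * w ^- 2) (- z^-1 * w ^- 2) (x^-1 / w - b ^+ 2 / z * w ^- 2).
Proof.
move=> hz hx hb.
rewrite (@Phi_t4_D_unit (1 : F) (w ^- 2) 1 z^-1 1).
- phie.
- fldn.
- fldn.
- fldn.
- mem.
- mem.
- nz.
- nz.
- nz.
- ino_as (w ^+ 2 / z).
- ino_as (0 : F).
- ino_as (b / z).
- ino_as (0 : F).
Qed.

(** With l = 0, the quotient m/k would have valuation -1. Translating l by -1/b makes k equal to (1
    + z*w) w^-2; then D = z*w/(1 + z*w) has valuation 1 and still dominates C, of valuation 2. *)
Lemma t4_T9 z x b : isunit z -> isunit x -> isunit b ->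
  pi (t4 F w) (Phi 1 1 0 (b * w ^- 2) (z / w) (x^-1 / w)) =
  Phi (w ^- 2) w^-1 (- b^-1 / w) 0 ((x * b ^+ 2)^-1 / w) (- (b ^+ 2 / z) / w).
Proof.
move=> hz hx hb.
have hz1 : isunit (1 + z * w) by mem.
rewrite (@Phi_H _ _ _ _ _ _ (- b^-1) 0 0); [|nz|nz|mem|mem|mem].
rewrite (_ : Phi _ _ _ _ _ _ = Phi 1 1 (- b^-1) (b * w ^- 2 + (x * b)^-1 / w) ((1 + z * w) * w ^- 2) (x^-1 / w)); last by phie.
rewrite (@Phi_t4_D_unit (z * w / (1 + z * w)) (w ^- 2) w^-1 (1 + z * w)^-1 ((1 + z * w) / z)).
- rewrite (@Phi_t _ _ _ _ _ _ (- (b ^+ 2 / z) / w)); [|nz|nz|]; last by ino_as (- (x^-1 * w)).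
  rewrite (@Phi_H _ _ _ _ _ _ (- (z / (b * (1 + z * w)))) (- (x * b * (1 + z * w))^-1)
    (z / (x * b ^+ 2 * (1 + z * w)))); [phie|nz|nz|mem|mem|mem].
- fldn.
- fldn.
- fldn.
- mem.
- mem.
- nz.
- nz.
- nz.
- ino_as (w ^+ 2 / (1 + z * w)).
- ino_as (- (w ^+ 2 / (b * (1 + z * w)))).
- ino_as (b / (1 + z * w)).
- ino_as (w / (b ^+ 2 * z)).
Qed.

(** The translation of [t4_T9], together with the removal of the integral z, gives k = w^-2 and D =
    0, so that C dominates. *)
Lemma t4_T10 z x b : ino z -> isunit x -> isunit b ->
  pi (t4 F w) (Phi 1 1 0 (b * w ^- 2) z (x^-1 / w)) =
  Phi (w ^- 2) (w ^- 2) (- b^-1 * w ^- 2) 0 ((x * b ^+ 2)^-1 / w) 0.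
Proof.
move=> hz hx hb.
rewrite (@Phi_H _ _ _ _ _ _ (- b^-1) 0 (- z)); [|nz|nz|mem|mem|mem].
rewrite (_ : Phi _ _ _ _ _ _ = Phi 1 1 (- b^-1) (b * w ^- 2 + (x * b)^-1 / w) (w ^- 2) (x^-1 / w)); last by phie.
rewrite (@Phi_t4_C_unit (w ^+ 2 / b ^+ 2) 0 (w ^- 2) (w ^- 2) 1 (b ^+ 2)).
- rewrite (@Phi_t _ _ _ _ _ _ 0); [|nz|nz|]; last by ino_as (- ((2%:R * b ^+ 2 + w / x) * w ^+ 2)).
  rewrite (@Phi_H _ _ _ _ _ _ 0 (- (b + w / (x * b))) 0); [phie|nz|nz|mem|mem|mem].
- fldn.
- fldn.
- fldn.
- fldn.
- mem.
- mem.
- nz.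
- nz.
- nz.
- ino_as (w ^+ 2).
- ino_as (- (w ^+ 2 / b)).
- ino_as b.
- ino_as (0 : F).
Qed.

(** * Changes of variables *)

Ltac unit_as e := match goal with |- is_true (Defs.isunit _ _ ?x) => rewrite (_ : x = e); [mem | fldn] end.
Ltac inp_as e := match goal with |- is_true (Defs.inp _ _ 1 ?x) => rewrite (_ : x = e); [mem | fldn] end.
Ltac chi_as s e := apply: (@chi_eq s); [mem | mem | inp_as e].
Ltac invn_tac := bij_goal; congr (_, _, _, _); fldn.

Definition gPa (p : pt) := pi (t4 F w) (fPa (w ^- 3) p).
Definition gPb (p : pt) := pi (t4 F w) (fPb (w ^- 3) p).
Definition gPc (p : pt) := pi (t4 F w) (fPc (w ^- 3) p).

(** The new z is -z/(a*b), so that 1 minus it is (z + a*b)/(a*b): the condition [U1] encodes that z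
    and z + a*b are units. *)
Lemma Pc3_T12 :
  E4 (fun '(z, x, b, a) => [&& isunit z, ino x, isunit b, isunit a & isunit (z + a * b)]) gPc =
  E4 (prodS U1 ino isunit isunit) fT12.
Proof.
apply: (@E4_bij _ _ _ _
  (fun '(z, x, b, a) => (- (z / (a * b)), (x * b + a * w) / z, - (a / (z + a * b)), b / z))
  (fun '(z, y, b, a) => (- (a * b * (1 - z))^-1,
     (y * - (a * b * (1 - z))^-1 + (a * z)^-1 * w) * - (b * (1 - z)),
     - (b * (1 - z))^-1, - (a * z)^-1))).
- dom4_tac.
- dom4_tac.
- case=> [[[z x] b] a] /and5P[hz hx hb ha he]; spl; try mem.
  by apply: U1I; [mem | unit_as ((z + a * b) / (a * b))].
- bij_goal; try mem.
  match goal with |- is_true (Defs.isunit _ _ (- (?a * ?b * (1 - ?z))^-1 + _)) => unit_as ((a * b * z)^-1) end.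
- case=> [[[z x] b] a] /and5P[hz hx hb ha he].
  have -> : (1 - - (z / (a * b))) = (z + a * b) / (a * b) by fldn.
  by congr (_, _, _, _); fldn.
- bij_goal.
  match goal with |- (_, _, ?X, _) = (?z, _, ?b, ?a) => 
    have -> : - (a * b * (1 - z))^-1 + - (a * z)^-1 * - (b * (1 - z))^-1 = (a * b * z)^-1 by fldn end.
  by congr (_, _, _, _); fldn.
- lip4_tac.
- lip4_tac.
- exact: fT12_lip.
- case=> [[[z x] b] a] /and5P[hz hx hb ha he]; rewrite /gPc /fPc /fT12 piZ t4_T12 //.
  have -> : (1 - - (z / (a * b))) = (z + a * b) / (a * b) by fldn.
  congr (_ *: _); last by phie.
  by chi_as ((a * b)^-1) (0 : F).
Qed.

(** The dummy is z + a*b; as it lies in p, a*b is congruent to -z, which makes chi depend on z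
    alone. *)
Lemma Pc3_T4 :
  E4 (fun '(z, x, b, a) => [&& isunit z, ino x, isunit b, isunit a & inp 1 (z + a * b)]) gPc =
  E4 (prodS isunit isunit ino (inp 1)) fT4.
Proof.
apply: (@E4_bij _ _ _ _
  (fun '(z, x, b, a) => (b / z, - z^-1, (x * b + a * w) / z, z + a * b))
  (fun '(x, b, a, d) => (- b^-1,
      (a * - b^-1 + (d + b^-1) / (x / b) * w) / - (x / b),
      - (x / b), (d + b^-1) / - (x / b)))).
- dom4_tac.
- dom4_tac.
- map_tac.
- case=> [[[x b] a] d] /and4P[hx hb ha hd]; spl; try mem.
  by inp_as d.
- invn_tac.
- invn_tac.
- lip4_tac.
- lip4_tac.
- exact: fT4_lip.
- case=> [[[z x] b] a] /and5P[hz hx hb ha he]; rewrite /gPc /fPc /fT4 piZ t4_T4 //.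
  congr (_ *: _); last by phie.
  by chi_as (z^-1) (- ((z + a * b) / z ^+ 2)).
Qed.

Lemma Pc3_T14 :
  E4 (prodS (inp 1) ino isunit isunit) gPc = E4 (prodS ino isunit isunit (inp 1)) fT14.
Proof.
apply: (@E4_bij _ _ _ _
  (fun '(z, x, b, a) => (- (x + a ^+ 2 * w / (z + a * b)), (z + a * b)^-1, a / (z + a * b), z))
  (fun '(x, b, a, d) => (d, - x - (a / b) ^+ 2 * w * b, (b^-1 - d) / (a / b), a / b))).
- dom4_tac.
- dom4_tac.
- map_tac.
- map_tac.
- invn_tac.
- case=> [[[x b] a] d] /and4P[hx hb ha hd].
  have -> : d + a / b * ((b^-1 - d) / (a / b)) = b^-1 by fldn.
  by congr (_, _, _, _); fldn.
- lip4_tac.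
- lip4_tac.
- exact: fT14_lip.
- case=> [[[z x] b] a] /and4P[hz hx hb ha]; rewrite /gPc /fPc /fT14 piZ t4_T14 //.
  by congr (_ *: _); chi_as ((z + a * b)^-1) (z / (z + a * b) ^+ 2).
Qed.

(** This is the part of T^13 with x in 1+p, where x = 1 + z; the part with 1 - x a unit comes from
    [gPb]. *)
Lemma Pa3_T13 :
  E4 (prodS (inp 1) (inp 1) isunit isunit) gPa =
  E4 (fun '(x, b, a, d) => [&& isunit x, isunit b, isunit a, inp 1 d & inp 1 (x - 1)]) fT13.
Proof.
apply: (@E4_bij _ _ _ _
  (fun '(z, x, b, a) => (1 + z, (z + (a + x * b) * b)^-1, - (a + x * b)^-1, x))
  (fun '(x, b, a, d) => (x - 1, d, (x - 1 - b^-1) * a,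
                         - a^-1 - d * ((x - 1 - b^-1) * a)))).
- dom4_tac.
- dom4_tac.
- case=> [[[z x] b] a] /and4P[hz hx hb ha]; spl; try mem.
  by inp_as z.
- map_tac.
- invn_tac.
- case=> [[[x b] a] d] /and5P[hx hb ha hd h1].
  have -> : - a^-1 - d * ((x - 1 - b^-1) * a) + d * ((x - 1 - b^-1) * a) = - a^-1 by ring.
  have -> : x - 1 + - a^-1 * ((x - 1 - b^-1) * a) = b^-1 by fldn.
  by congr (_, _, _, _); fldn.
- lip4_tac.
- lip4_tac.
- move=> [[[x b] a] d] [[[x' b'] a'] d'] /and5P[? ? ? ? _] /and5P[? ? ? ? _] l.
  by apply: fT13_lip => //; apply/and4P.
- case=> [[[z x] b] a] /and4P[hz hx hb ha]; rewrite /gPa /fPa /fT13 piZ t4_T13a //; last by mem.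
  have hz' := inp1_div hz; have he : isunit (z + (a + x * b) * b) by mem.
  congr (_ *: _).
    by chi_as ((z + (a + x * b) * b)^-1)
      ((z + x * b * b + z * (z + (a + x * b) * b)) / (z + (a + x * b) * b) ^+ 2).
  (* The k coordinate of T^13 is integral here because 1 - x = -z lies in p, so it may replace 0. *)
  rewrite (@Phi_H _ _ _ _ _ _ 0 0 (- (z / w / (z + (a + x * b) * b)))); [phie|nz|nz|mem|mem|mem].
Qed.

(* Common form of the contributions of x in p (z a unit) and of x a unit
   (z and x z + a (a + x b) units). *)
Definition fM (p : pt) : V := let: (z, x, b, a) := p in
  chi (a * b) *: Phi w^-1 1 (- ((a + x * b) / z) / w) (b / z * w ^- 2) (- z^-1 * w ^- 3)
    ((z + a * b) / (x * z + a * (a + x * b)) / w).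

Lemma Pa3_M : E4 (prodS isunit (inp 1) isunit isunit) gPa = E4 (prodS isunit (inp 1) isunit isunit) fM.
Proof.
apply: eq_E4 => -[[[z x] b] a] _ /and4P[hz hx hb ha]; rewrite /gPa /fPa /fM piZ.
have hu : isunit (a + x * b) by mem.
have he : isunit (x * z + a * (a + x * b)) by mem.
have hxw := inp1_div hx.
rewrite t4_C2 //; congr (_ *: _); apply: Phi_t; [nz | nz |].
(* The difference of the t coordinates is divisible by x/w, integral since x is in p. *)
ino_as (- (x / w * z ^+ 2 / ((a + x * b) ^+ 2 * (x * z + a * (a + x * b))))).
Qed.

Lemma Pb3_M :
  E4 (fun '(z, x, b, a) => [&& isunit z, isunit x, isunit b, isunit a &
                              isunit (x * z + a * (a + x * b))]) gPb =
  E4 (fun '(z, x, b, a) => [&& isunit z, isunit x, isunit b, isunit a &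
                              isunit (x * z + a * (a + x * b))]) fM.
Proof.
apply: eq_E4 => -[[[z x] b] a] _ /and5P[hz hx hb ha he]; rewrite /gPb /fPb /fM piZ.
by rewrite t4_R1.
Qed.

Local Notation e_ z x b a := (x * z + a * (a + x * b)).

Lemma M_T5 :
  E4 (fun '(z, x, b, a) => [&& isunit z, ino x, isunit b, isunit a, isunit (e_ z x b a)
                              & inp 1 (z + a * b)]) fM =
  E4 (prodS ino isunit isunit (inp 1)) fT5.
Proof.
apply: (@E4_bij _ _ _ _
  (fun '(z, x, b, a) => (- ((a + x * b) / z), - z^-1, b / z, z + a * b))
  (fun '(x, b, a, d) => (- b^-1, (x / b - (d + b^-1) / - (a / b)) / - (a / b), - (a / b),
                         (d + b^-1) / - (a / b)))).
- dom4_tac.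
- dom4_tac.
- map_tac.
- case=> [[[x b] a] d] /and4P[hx hb ha hd]; spl; try mem.
    unit_as (((d + b^-1) / - (a / b)) ^+ 2 + (x / b - (d + b^-1) / - (a / b)) / - (a / b) * d).
  by inp_as d.
- invn_tac.
- invn_tac.
- lip4_tac.
- lip4_tac.
- exact: fT5_lip.
- case=> [[[z x] b] a] /and5P[hz hx hb ha /andP[he hd]]; rewrite /fM /fT5; congr (_ *: _).
    by chi_as (z^-1) (- ((z + a * b) / z ^+ 2)).
  rewrite (@Phi_t _ _ _ _ _ _ 0); [phie | nz | nz | rewrite sub0r].
  apply/inoN; rewrite mulrAC; apply: inoM; first exact: inp1_div.
  by mem.
Qed.

(** The new variables satisfy 1 - y = a*b/(z + a*b) and 1 - x = b*e/((z + a*b)*(a + x*b)) with e the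
    value of [e_], which turns the unit conditions into [U1]. *)
Lemma M_T2 :
  E4 (fun '(z, x, b, a) => [&& isunit z, ino x, isunit b, isunit a & [&& isunit (e_ z x b a),
                               isunit (z + a * b) & isunit (a + x * b)]]) fM =
  E4 (prodS U1 isunit isunit U1) fT2.
Proof.
apply: (@E4_bij _ _ _ _
  (fun '(z, x, b, a) => (z / (z + a * b), - ((a + x * b) / z), - (b / z),
                         a * z / ((z + a * b) * (a + x * b))))
  (fun '(y, b, a, x) => ((1 - y) / (a * b * x), b * (1 - x / y) / a, - ((1 - y) / (b * x)),
                         - ((1 - y) / (a * y))))).
- dom4_tac.
- dom4_tac.
- case=> [[[z x] b] a] /and5P[hz hx hb ha /and3P[he hs hu]]; spl; try mem.
    by apply: U1I; [mem | unit_as (a * b / (z + a * b))].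
  apply: U1I; first by mem.
  by unit_as (b * e_ z x b a / ((z + a * b) * (a + x * b))).
- case=> [[[y b] a] x] /and4P[/U1P[hy hy1] hb ha /U1P[hx hx1]]; spl; try mem.
  + unit_as ((1 - y) * (1 - x) / (a ^+ 2 * x * y)).
  + unit_as ((1 - y) / (a * b * x * y)).
  + unit_as (- ((1 - y) / (a * x))).
- case=> [[[z x] b] a] /and5P[hz hx hb ha /and3P[he hs hu]].
  have -> : 1 - z / (z + a * b) = a * b / (z + a * b) by fldn.
  by congr (_, _, _, _); fldn.
- case=> [[[y b] a] x] /and4P[/U1P[hy hy1] hb ha /U1P[hx hx1]].
  have -> : (1 - y) / (a * b * x) + - ((1 - y) / (a * y)) * - ((1 - y) / (b * x)) = (1 - y) / (a * b * x * y) by fldn.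
  have -> : - ((1 - y) / (a * y)) + b * (1 - x / y) / a * - ((1 - y) / (b * x)) = - ((1 - y) / (a * x)) by fldn.
  by congr (_, _, _, _); fldn.
- lip4_tac.
- lip4_tac.
- exact: fT2_lip.
- case=> [[[z x] b] a] /and5P[hz hx hb ha /and3P[he hs hu]]; rewrite /fM /fT2.
  have -> : 1 - z / (z + a * b) = a * b / (z + a * b) by fldn.
  have -> : 1 - a * z / ((z + a * b) * (a + x * b)) = b * e_ z x b a / ((z + a * b) * (a + x * b)) by fldn.
  congr (_ *: _); last by phie.
  by chi_as ((z + a * b)^-1) (0 : F).
Qed.

(** The dummy a + x*b makes the l coordinate integral, so it is translated to 0. The new z satisfies
    1 - z = e/a^2, with e the value of [e_]. *)
Lemma M_T3 :
  E4 (fun '(z, x, b, a) => [&& isunit z, isunit x, isunit b, isunit a & [&& isunit (e_ z x b a),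
                               isunit (z + a * b) & inp 1 (a + x * b)]]) fM =
  E4 (prodS U1 isunit isunit (inp 1)) fT3.
Proof.
apply: (@E4_bij _ _ _ _
  (fun '(z, x, b, a) => (- ((z + a * b) * x / a ^+ 2), - (x / e_ z x b a), - (a / e_ z x b a), a + x * b))
  (fun '(z, b, a, d) => (- ((1 + d * a) / b), - (b / (a ^+ 2 * (1 - z))),
                         - ((d * a ^+ 2 * (1 - z) + a) / b), - (a * (1 - z))^-1))).
- dom4_tac.
- dom4_tac.
- case=> [[[z x] b] a] /and5P[hz hx hb ha /and3P[he hs hu]]; spl; try mem.
  by apply: U1I; [mem | unit_as (e_ z x b a / a ^+ 2)].
- case=> [[[z b] a] d] /and4P[/U1P[hz hz1] hb ha hd]; spl; try mem.
  + unit_as ((a ^+ 2 * (1 - z))^-1).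
  + unit_as (z / (b * (1 - z))).
  + inp_as d.
- case=> [[[z x] b] a] /and5P[hz hx hb ha /and3P[he hs hu]].
  have -> : 1 - - ((z + a * b) * x / a ^+ 2) = e_ z x b a / a ^+ 2 by fldn.
  by congr (_, _, _, _); fldn.
- case=> [[[z b] a] d] /and4P[/U1P[hz hz1] hb ha hd].
  have -> : e_ (- ((1 + d * a) / b)) (- (b / (a ^+ 2 * (1 - z))))
               (- ((d * a ^+ 2 * (1 - z) + a) / b)) (- (a * (1 - z))^-1) = (a ^+ 2 * (1 - z))^-1 by fldn.
  by congr (_, _, _, _); fldn.
- lip4_tac.
- lip4_tac.
- exact: fT3_lip.
- case=> [[[z x] b] a] /and5P[hz hx hb ha /and3P[he hs hu]]; rewrite /fM /fT3.
  have -> : 1 - - ((z + a * b) * x / a ^+ 2) = e_ z x b a / a ^+ 2 by fldn.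
  congr (_ *: _); first by chi_as ((a * b)^-1) (- ((a + x * b) / (a ^+ 2 * b))).
  have huw := inp1_div hu.
  by rewrite (@Phi_H _ _ _ _ _ _ ((a + x * b) / w / z) 0 0); [phie|nz|nz|mem|mem|mem].
Qed.

Lemma Pb3_T8 :
  E4 (fun '(z, x, b, a) => [&& isunit z, isunit x, isunit b, isunit a & isunit (a + x * b)
                               && inp 1 (e_ z x b a)]) gPb =
  E4 (prodS U1 isunit isunit (inp 1)) fT8.
Proof.
apply: (@E4_bij _ _ _ _
  (fun '(z, x, b, a) => (z / (b * (a + x * b)), - ((a + x * b) / z), b / z, e_ z x b a))
  (fun '(z, b, a, d) => (- (a * b * z)^-1, (a * b * z ^+ 2 * d - b / a) / (1 - z), - (b * z)^-1,
                         (a * z * d - a^-1) / (1 - z)))).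
- dom4_tac.
- dom4_tac.
- case=> [[[z x] b] a] /and5P[hz hx hb ha /andP[hu he]]; spl; try mem.
  apply: U1I; first by mem.
  by unit_as ((b * e_ z x b a - (a + x * b) * z) / a / (b * (a + x * b))).
- case=> [[[z b] a] d] /and4P[/U1P[hz hz1] hb ha hd]; spl; try mem.
  + unit_as ((a * z)^-1).
  + inp_as d.
- case=> [[[z x] b] a] /and5P[hz hx hb ha /andP[hu he]].
  (* Since [e_] is in p and a + x*b is a unit, this form is visibly a unit; it equals b*(a + x*b) -
     z, the numerator of 1 minus the new z. *)
  have hs : isunit ((b * e_ z x b a - (a + x * b) * z) / a) by mem.
  have es : (b * e_ z x b a - (a + x * b) * z) / a = b * (a + x * b) - z by fldn.
  rewrite es in hs.
  have -> : 1 - z / (b * (a + x * b)) = (b * (a + x * b) - z) / (b * (a + x * b)) by fldn.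
  by congr (_, _, _, _); fldn.
- case=> [[[z b] a] d] /and4P[/U1P[hz hz1] hb ha hd].
  have -> : (a * z * d - a^-1) / (1 - z) + (a * b * z ^+ 2 * d - b / a) / (1 - z) * - (b * z)^-1 = (a * z)^-1 by fldn.
  by congr (_, _, _, _); fldn.
- lip4_tac.
- lip4_tac.
- exact: fT8_lip.
- case=> [[[z x] b] a] /and5P[hz hx hb ha /andP[hu he]].
  rewrite /gPb /fPb /fT8 piZ t4_T8 //.
  have hs : isunit ((b * e_ z x b a - (a + x * b) * z) / a) by mem.
  have es : (b * e_ z x b a - (a + x * b) * z) / a = b * (a + x * b) - z by fldn.
  rewrite es in hs.
  have -> : 1 - z / (b * (a + x * b)) = (b * (a + x * b) - z) / (b * (a + x * b)) by fldn.
  congr (_ *: _); last by phie.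
  by chi_as ((a * b)^-1) (- (e_ z x b a / (a * z * (a + x * b)))).
Qed.

Lemma Pb3_T13 :
  E4 (fun '(z, x, b, a) => [&& inp 1 z, isunit x, isunit b, isunit a & isunit (a + x * b)]) gPb =
  E4 (fun '(x, b, a, d) => [&& isunit x, isunit b, isunit a, inp 1 d & isunit (1 - x)]) fT13.
Proof.
apply: (@E4_bij _ _ _ _
  (fun '(z, x, b, a) => (e_ z x b a / a ^+ 2, a ^+ 2 / (e_ z x b a * (z + a * b)),
                         - (a / e_ z x b a), z))
  (fun '(x, b, a, d) => (d, - ((1 - x) * b / (a ^+ 2 * x)), (d * x - b^-1) * a, - (a * x)^-1))).
- dom4_tac.
- dom4_tac.
- case=> [[[z x] b] a] /and5P[hz hx hb ha hu]; spl; try mem.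
  by unit_as (- (x * (z + a * b) / a ^+ 2)).
- case=> [[[x b] a] d] /and5P[hx hb ha hd hx1]; spl; try mem.
  by unit_as (- ((1 + (1 - x) * b * d) / a)).
- case=> [[[z x] b] a] /and5P[hz hx hb ha hu].
  have he : isunit (e_ z x b a) by mem.
  have hs : isunit (z + a * b) by mem.
  have -> : 1 - e_ z x b a / a ^+ 2 = - (x * (z + a * b) / a ^+ 2) by fldn.
  by congr (_, _, _, _); fldn.
- case=> [[[x b] a] d] /and5P[hx hb ha hd hx1].
  have -> : e_ d (- ((1 - x) * b / (a ^+ 2 * x))) ((d * x - b^-1) * a) (- (a * x)^-1) = (a ^+ 2 * x)^-1 by fldn.
  have -> : d + - (a * x)^-1 * ((d * x - b^-1) * a) = (b * x)^-1 by fldn.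
  by congr (_, _, _, _); fldn.
- lip4_tac.
- lip4_tac.
- move=> [[[x b] a] d] [[[x' b'] a'] d'] /and5P[? ? ? ? _] /and5P[? ? ? ? _] l.
  by apply: fT13_lip => //; apply/and4P.
- case=> [[[z x] b] a] /and5P[hz hx hb ha hu].
  have he : isunit (e_ z x b a) by mem.
  have hs : isunit (z + a * b) by mem.
  rewrite /gPb /fPb /fT13 piZ t4_T13b //.
  have -> : 1 - e_ z x b a / a ^+ 2 = - (x * (z + a * b) / a ^+ 2) by fldn.
  congr (_ *: _); last by phie.
  by chi_as ((z + a * b)^-1) (z / (z + a * b) ^+ 2).
Qed.

(* The part of the second piece where z and a + x b lie in p depends on a and b only
   through a / x. *)
Definition gR s (p : pt) : V := let: (z, x, b, d) := p in
  pi (t4 F w) (chi (- x) *: Phi 1 1 0 (b * w ^- 2) (z * s) (x^-1 / w)).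

Lemma gR_lip n p p' : (n <= 6)%N -> prodS ino isunit isunit (inp 1) p ->
  prodS ino isunit isunit (inp 1) p' -> lip4 p p' -> gR (w ^- n) p = gR (w ^- n) p'.
Proof.
move: p p' => [[[z x] b] d] [[[z' x'] b'] d'] hn /and4P[hz hx hb hd] /and4P[hz' hx' hb' hd'] /and4P[lz lx lb ld].
have ls : lip 6 (w ^- n) (w ^- n) by apply: lip_le hn (lip_wXV n).
by rewrite /gR; congr (pi _ _); termlip.
Qed.

Lemma Pb3_R :
  E4 (fun '(z, x, b, a) => [&& inp 1 z, isunit x, isunit b, isunit a & inp 1 (a + x * b)]) gPb =
  E4 (prodS (inp 1) isunit isunit (inp 1)) (gR (w ^- 3)).
Proof.
apply: (@E4_bij _ _ _ _
  (fun '(z, x, b, a) => (z + (a + x * b) * a / x, x, - (a / x), a + x * b))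
  (fun '(z, x, b, d) => (z + d * b, x, (d + x * b) / x, - (x * b)))).
- dom4_tac.
- dom4_tac.
- map_tac.
- case=> [[[z x] b] d] /and4P[hz hx hb hd]; spl; try mem.
  by inp_as d.
- invn_tac.
- invn_tac.
- lip4_tac.
- lip4_tac.
- move=> [[[z x] b] d] [[[z' x'] b'] d'] /and4P[hz hx hb hd] /and4P[hz' hx' hb' hd'] l.
  by apply: gR_lip => //; apply/and4P; split => //; exact: inp1_ino.
- case=> [[[z x] b] a] /and5P[hz hx hb ha hu]; rewrite /gPb /fPb /gR Phi_R4 //.
  congr (pi _ (_ *: _)).
  by chi_as (b^-1) (- ((a + x * b) / b)).
Qed.

(** Applied twice, this separates the valuations of the z in [gR (w ^- 3)]: valuation 1 gives T^6,
    valuation 2 gives T^9 and larger valuation T^10, with one factor 1/q per step. *)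
Lemma gR_scale n : (n < 6)%N ->
  E4 (prodS (inp 1) isunit isunit (inp 1)) (gR (w ^- n.+1)) =
  Q^-1 *: E4 (prodS ino isunit isunit (inp 1)) (gR (w ^- n)).
Proof.
move=> hn; rewrite E4_scale1; last first.
- move=> [[[z x] b] d] [[[z' x'] b'] d'] /and4P[hz hx hb hd] /and4P[hz' hx' hb' hd'] l.
  by apply: gR_lip => //; apply/and4P; split => //; exact: inp1_ino.
- by case=> [[[z x] b] d] /and4P[].
- by dom4_tac.
congr (_ *: _); rewrite (@E4_pred _ (prodS ino isunit isunit (inp 1))); last first.
  by case=> [[[z x] b] d] /and4P[hz hx hb hd] /=; rewrite hz hx hb hd inp1w hz.
apply: eq_E4 => -[[[z x] b] d] _ _; rewrite /gR; congr (pi _ (_ *: Phi _ _ _ _ _ _)).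
rewrite exprS; fldn; rewrite ?expf_neq0 ?w_neq0 //.
Qed.

(** The factor 1 - x*w of T^6 comes from the t coordinate, 1/(x*w) - b^2/(z*w^2) = -(b^2/(z*w^2))*(1
    - (z/(x*b^2))*w), with new x equal to z/(x*b^2). *)
Lemma gR_T6 : E4 (prodS isunit isunit isunit (inp 1)) (gR (w ^- 2)) =
  E4 (prodS isunit isunit isunit (inp 1)) fT6.
Proof.
apply: (@E4_bij _ _ _ _
  (fun '(z, x, b, d) => (z / (x * b ^+ 2), - (z * (1 - z / (x * b ^+ 2) * w))^-1, b / z, d))
  (fun '(x, b, a, d) => (- (b * (1 - x * w))^-1, - (b * (1 - x * w) / (x * a ^+ 2)),
                         - (a / (b * (1 - x * w))), d))).
- dom4_tac.
- dom4_tac.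
- map_tac.
- map_tac.
- case=> [[[z x] b] d] /and4P[hz hx hb hd].
  have h : isunit (x * b ^+ 2 - z * w) by mem.
  have -> : 1 - z / (x * b ^+ 2) * w = (x * b ^+ 2 - z * w) / (x * b ^+ 2) by fldn.
  by congr (_, _, _, _); fldn.
- case=> [[[x b] a] d] /and4P[hx hb ha hd].
  have h : isunit (1 - x * w) by mem.
  have -> : - (b * (1 - x * w))^-1 / (- (b * (1 - x * w) / (x * a ^+ 2)) * (- (a / (b * (1 - x * w)))) ^+ 2) = x by fldn.
  by congr (_, _, _, _); fldn.
- lip4_tac.
- lip4_tac.
- exact: fT6_lip.
- case=> [[[z x] b] d] /and4P[hz hx hb hd].
  have h : isunit (x * b ^+ 2 - z * w) by mem.
  rewrite /gR /fT6 piZ t4_T6 //.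
  have -> : 1 - z / (x * b ^+ 2) * w = (x * b ^+ 2 - z * w) / (x * b ^+ 2) by fldn.
  congr (_ *: _); last by phie.
  by chi_as ((x * b)^-1) (- (z * w / (x * b ^+ 2 * (x * b ^+ 2 - z * w)))).
Qed.

Lemma gR_T9 : E4 (prodS isunit isunit isunit (inp 1)) (gR (w ^- 1)) =
  E4 (prodS isunit isunit isunit (inp 1)) fT9.
Proof.
apply: (@E4_bij _ _ _ _
  (fun '(z, x, b, d) => (- (b ^+ 2 / z), - (x * b ^+ 2)^-1, - b^-1, d))
  (fun '(x, b, a, d) => (- (a ^+ 2 * x)^-1, - (a ^+ 2 / b), - a^-1, d))).
- dom4_tac.
- dom4_tac.
- map_tac.
- map_tac.
- invn_tac.
- invn_tac.
- lip4_tac.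
- lip4_tac.
- exact: fT9_lip.
- case=> [[[z x] b] d] /and4P[hz hx hb hd].
  rewrite /gR /fT9 piZ expr1 t4_T9 //.
  congr (_ *: _); last by phie.
  by chi_as ((x * b)^-1) (0 : F).
Qed.

Lemma gR_T10 : E4 (prodS (inp 1) isunit isunit (inp 1)) (gR (w ^- 1)) =
  E4 (prodS isunit isunit (inp 1) (inp 1)) fT10.
Proof.
apply: (@E4_bij _ _ _ _
  (fun '(z, x, b, d) => (- (x * b ^+ 2)^-1, - b^-1, z, d))
  (fun '(b, a, z, d) => (z, - (a ^+ 2 / b), - a^-1, d))).
- dom4_tac.
- dom4_tac.
- map_tac.
- map_tac.
- invn_tac.
- invn_tac.
- lip4_tac.
- lip4_tac.
- exact: fT10_lip.
- case=> [[[z x] b] d] /and4P[hz hx hb hd].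
  rewrite /gR /fT10 piZ expr1 t4_T10 //; last exact: inp1_div.
  congr (_ *: _); last by phie.
  by chi_as ((x * b)^-1) (0 : F).
Qed.

(** * The decomposition *)

Lemma notunit x : ino x -> ~~ isunit x = inp 1 x.
Proof. by move=> hx; rewrite unitE hx /= negbK. Qed.

Lemma notp x : ino x -> ~~ inp 1 x = isunit x.
Proof. by move=> hx; rewrite unitE hx. Qed.

Ltac regroup := apply/idP/idP => ?; brk; spl; try mem.

Lemma E4_split_z (S2 S3 S4 : pred F) (f : pt -> V) :
  E4 (prodS ino S2 S3 S4) f = E4 (prodS isunit S2 S3 S4) f + E4 (prodS (inp 1) S2 S3 S4) f.
Proof.
rewrite (E4_split (fun '(z, x, b, a) => inp 1 z)) addrC; congr (_ + _); apply: E4_pred.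
  case=> [[[z x] b] a] /and4P[hz _ _ _] /=; rewrite hz (unitE z) hz /=.
  by case: (inp 1 z); rewrite ?andbF ?andbT.
case=> [[[z x] b] a] /and4P[hz _ _ _] /=; rewrite hz /=.
by case: (inp 1 z); rewrite ?andbF ?andbT.
Qed.

Lemma E4_split3 (P : pred pt) (S S1 S2 : pred pt) (f : pt -> V) :
  (forall p, ino4 p -> (S p && P p) = S1 p) -> (forall p, ino4 p -> (S p && ~~ P p) = S2 p) ->
  E4 S f = E4 S1 f + E4 S2 f.
Proof. by move=> h1 h2; rewrite (E4_split P) (E4_pred _ h1) (E4_pred _ h2). Qed.

Lemma Pc3E : E4 (prodS ino ino isunit isunit) gPc =
  E4 (prodS U1 ino isunit isunit) fT12 + E4 (prodS isunit isunit ino (inp 1)) fT4 +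
  E4 (prodS ino isunit isunit (inp 1)) fT14.
Proof.
rewrite E4_split_z Pc3_T14 -Pc3_T12 -Pc3_T4; congr (_ + _).
apply: (@E4_split3 (fun '(z, x, b, a) => isunit (z + a * b))) => -[[[z x] b] a] /and4P[hz hx hb ha] /=.
  by regroup.
by rewrite notunit; [regroup | mem].
Qed.

Lemma fT13_split : E4 (prodS isunit isunit isunit (inp 1)) fT13 =
  E4 (fun '(x, b, a, d) => [&& isunit x, isunit b, isunit a, inp 1 d & inp 1 (x - 1)]) fT13 +
  E4 (fun '(x, b, a, d) => [&& isunit x, isunit b, isunit a, inp 1 d & isunit (1 - x)]) fT13.
Proof.
apply: (@E4_split3 (fun '(x, b, a, d) => inp 1 (x - 1))) => -[[[x b] a] d] /and4P[hx _ _ _] /=.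
  by regroup.
rewrite -(notp (x := 1 - x)); last by mem.
suff -> : inp 1 (x - 1) = inp 1 (1 - x) by regroup.
by apply/idP/idP => /inpN; rewrite opprB.
Qed.

(** For x in p the value of [e_] is automatically a unit, so the left side is one sum of [fM] over
    all x in o with [e_] a unit; it is cut according to z + a*b and then a + x*b. *)
Lemma M_E : E4 (prodS isunit (inp 1) isunit isunit) gPa +
  E4 (fun '(z, x, b, a) => [&& isunit z, isunit x, isunit b, isunit a & isunit (e_ z x b a)]) gPb =
  E4 (prodS ino isunit isunit (inp 1)) fT5 + E4 (prodS U1 isunit isunit U1) fT2 +
  E4 (prodS U1 isunit isunit (inp 1)) fT3.
Proof.
rewrite Pa3_M Pb3_M -M_T5 -M_T2 -M_T3 -addrA.
rewrite -(@E4_split3 (fun '(z, x, b, a) => inp 1 x)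
  (fun '(z, x, b, a) => [&& isunit z, ino x, isunit b, isunit a & isunit (e_ z x b a)])).
- rewrite (@E4_split3 (fun '(z, x, b, a) => inp 1 (z + a * b)) _
    (fun '(z, x, b, a) => [&& isunit z, ino x, isunit b, isunit a, isunit (e_ z x b a) & inp 1 (z + a * b)])
    (fun '(z, x, b, a) => [&& isunit z, ino x, isunit b, isunit a, isunit (e_ z x b a) & isunit (z + a * b)])).
  + congr (_ + _); apply: (@E4_split3 (fun '(z, x, b, a) => isunit (a + x * b))) => -[[[z x] b] a] /and4P[hz hx hb ha] /=.
      by regroup.
    rewrite notunit; last by mem.
    regroup.
    (* If a + x*b is in p, then x is forced to be a unit, as [M_T3] requires. *)
    by unit_as ((a + x * b - a) / b).
  + by case=> [[[z x] b] a] /and4P[hz hx hb ha] /=; regroup.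
  + case=> [[[z x] b] a] /and4P[hz hx hb ha] /=; rewrite notp; [regroup | mem].
- case=> [[[z x] b] a] /and4P[hz hx hb ha] /=; regroup.
- case=> [[[z x] b] a] /and4P[hz hx hb ha] /=; rewrite notp; [regroup | mem].
Qed.

Lemma PabE : E4 (prodS ino (inp 1) isunit isunit) gPa + E4 (prodS ino isunit isunit isunit) gPb =
  E4 (prodS U1 isunit isunit U1) fT2 + E4 (prodS U1 isunit isunit (inp 1)) fT3 +
  E4 (prodS ino isunit isunit (inp 1)) fT5 +
  E4 (prodS U1 isunit isunit (inp 1)) fT8 + E4 (prodS isunit isunit isunit (inp 1)) fT13 +
  Q^-1 *: (E4 (prodS isunit isunit isunit (inp 1)) fT6 +
    Q^-1 *: (E4 (prodS isunit isunit isunit (inp 1)) fT9 +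
             E4 (prodS isunit isunit (inp 1) (inp 1)) fT10)).
Proof.
rewrite (E4_split_z _ _ _ gPa) (E4_split_z _ _ _ gPb) Pa3_T13 fT13_split.
rewrite (@E4_split3 (fun '(z, x, b, a) => isunit (e_ z x b a)) (prodS isunit isunit isunit isunit)
  (fun '(z, x, b, a) => [&& isunit z, isunit x, isunit b, isunit a & isunit (e_ z x b a)])
  (fun '(z, x, b, a) => [&& isunit z, isunit x, isunit b, isunit a & isunit (a + x * b)
                               && inp 1 (e_ z x b a)])); first 1 last.
- by case=> [[[z x] b] a] _ /=; regroup.
- case=> [[[z x] b] a] /and4P[hz hx hb ha] /=.
  rewrite notunit; last by mem.
  regroup.
  (* If [e_] is in p while x*z is a unit, then a + x*b is forced to be a unit, so T^8 covers the
     whole case. *)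
  by unit_as ((e_ z x b a - x * z) / a).
rewrite (@E4_split3 (fun '(z, x, b, a) => isunit (a + x * b)) (prodS (inp 1) isunit isunit isunit)
  (fun '(z, x, b, a) => [&& inp 1 z, isunit x, isunit b, isunit a & isunit (a + x * b)])
  (fun '(z, x, b, a) => [&& inp 1 z, isunit x, isunit b, isunit a & inp 1 (a + x * b)])); first 1 last.
- by case=> [[[z x] b] a] _ /=; regroup.
- case=> [[[z x] b] a] /and4P[hz hx hb ha] /=.
  by rewrite notunit; [regroup | mem].
rewrite Pb3_T8 Pb3_T13 Pb3_R gR_scale // E4_split_z gR_T6 gR_scale // E4_split_z gR_T9 gR_T10.
rewrite !addrA (ACl (1*3*2*4*5*6)) /= M_E [LHS](ACl (2*3*1*5*4*6*7)) /=.
by [].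
Qed.

Lemma Tchi_pieces :
  Tchi F vo w K V q R chi pi v =
  Q ^+ 3 *: (E4 (prodS ino ino isunit isunit) (fun '(z, x, b, a) =>
               chi (a * b) *: pi (Lm F x *m nm F w a b (z * w ^- 4)) (pi (tau F w) v)) +
             E4 (prodS ino (inp 1) isunit isunit) (fun '(z, x, b, a) =>
               chi (a * b) *: pi (s1 F *m Lm F x *m nm F w a b (z * w ^- 4)) (pi (tau F w) v))) +
  Q ^+ 2 *: pi (t4 F w)
            (E4 (prodS ino ino isunit isunit) (fun '(z, x, b, a) =>
               chi (a * b) *: pi (Lm F x *m nm F w a b (z * w ^- 3)) (pi (tau F w) v)) +
             E4 (prodS ino (inp 1) isunit isunit) (fun '(z, x, b, a) =>
               chi (a * b) *: pi (s1 F *m Lm F x *m nm F w a b (z * w ^- 3)) (pi (tau F w) v))).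
Proof.
have piD u u' : pi (t4 F w) (u + u') = pi (t4 F w) u + pi (t4 F w) u'.
  by have := rep_linear _ _ _ _ _ hpi (t4 F w) 1 u u'; rewrite !scale1r.
have sLn_lip s z z' x x' b b' a a' : lip 4 s s ->
    inp 1 x -> inp 1 x' -> isunit b -> isunit b' -> isunit a -> isunit a' ->
    lip 0 z z' -> lip 0 x x' -> lip 0 b b' -> lip 0 a a' ->
    chi (a * b) *: pi (s1 F *m Lm F x *m nm F w a b (z * s)) (pi (tau F w) v) =
    chi (a' * b') *: pi (s1 F *m Lm F x' *m nm F w a' b' (z' * s)) (pi (tau F w) v).
  by move=> ls *; rewrite !sLn //; termlip.
have [l3 l4] := (lip_s3, lip_s4).
rewrite /Tchi /intO /intU /Defs.intP /Qk.
do 4![rewrite integ4E; [|dom_tac..|by move=> *;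
  first [ apply: Ln_lip | apply: sLn_lip
        | rewrite !pi_t4_Ln -(piZ (t4 F w)) -[in RHS](piZ (t4 F w)); congr (pi _ _); apply: Ln_lip
        | rewrite !pi_t4_sLn -(piZ (t4 F w)) -[in RHS](piZ (t4 F w)); congr (pi _ _); apply: sLn_lip ]]].
rewrite piD !scalerDr !addrA; congr (_ + _ + _ *: _ + _ *: _).
  by rewrite pi_E4; apply: eq_E4 => -[[[z x] b] a] _ _; rewrite pi_t4_Ln piZ.
by rewrite pi_E4; apply: eq_E4 => -[[[z x] b] a] _ _; rewrite pi_t4_sLn piZ.
Qed.

Lemma Tchi_sum : Tchi F vo w K V q R chi pi v = \sum_(1 <= k < 15) Tk F vo w K V q R chi pi k v.
Proof.
rewrite Tchi_pieces (S_pieces lip_s3) (S_pieces lip_s4) Pa4_T7 Pb4_T1 Pc4_T11.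
have piD u u' : pi (t4 F w) (u + u') = pi (t4 F w) u + pi (t4 F w) u'.
  by have := rep_linear _ _ _ _ _ hpi (t4 F w) 1 u u'; rewrite !scale1r.
rewrite !piD !piZ !pi_E4 -[fun p => _ (fPa _ p)]/gPa -[fun p => _ (fPb _ p)]/gPb -[fun p => _ (fPc _ p)]/gPc.
rewrite -[Q^-1 *: E4 _ gPa + _]scalerDr PabE Pc3E.
rewrite [in RHS]unlock /= addr0.
rewrite T1E T2E T3E T4E T5E T6E T7E T8E T9E T10E T11E T12E T13E T14E.
(* The left side lists T^7, T^1, T^11, then T^2, T^3, T^5, T^8, T^13, T^6, T^9, T^10, then T^12,
   T^4, T^14; the permutation sorts them. *)
rewrite !scalerDr !scalerA !addrA [LHS](ACl (2*4*5*13*6*9*1*7*10*11*3*12*8*14)) /=.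
have Q0 := Q_neq0.
by do ?[congr (_ + _)]; congr (_ *: _); field.
Qed.

End Twist.

Unset Implicit Arguments.

Theorem theorem4p2
  (F : fieldType) (vo : F -> int) (w : F) (q : nat) (R : seq F)
  (K : numClosedFieldType) (V : lmodType K)
  (chi : F -> K) (pi : 'M[F]_4 -> V -> V)
  (hF : local_field F vo w q R)
  (hchi : quad_char_cond_p F vo K chi)
  (hpi : smooth_rep F vo K V pi)
  (v : V) (hv : inV0 F vo K V pi v) :
  Tchi F vo w K V q R chi pi v =
  \sum_(1 <= k < 15) Tk F vo w K V q R chi pi k v.
Proof. exact: (Tchi_sum hF hchi hpi hv). Qed.
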